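(* Assume the setting and assumptions in the context, with $|A|=2^{\alpha}$. There is a positive integer $D_0$ (depending only on $d$ and $\alpha$) such that the following holds for every positive integer $m$. Let $\delta\in(0,1)$, $n\ge 1$, and $$\lambda> 72|A|^3\sqrt{2\ln(2d)}+9\ln(|A|/\delta)+18 .$$ For a sample $\mathcal S$ of size $n$ define $$\mathcal J_{\mathcal S,\lambda}(\Theta)=\mathcal R_{\mathcal S}(\Theta)+\frac{\lambda}{\sqrt n}\,\|\Theta\|_{\mathcal P}^2\,\ln\big(4(\|\Theta\|_{\mathcal P}+1)\big),$$ and let $\hat\Theta=\{\hat\theta(a)\}_{a\in A}$ be a minimizer (assumed to exist) of $\mathcal J_{\mathcal S,\lambda}$ over all families $\Theta=\{\theta(a)\}_{a\in A}$ in which each $f(\cdot,\theta(a))$ is a residual network of size $(d,(6^{\alpha}+1)m,D_0,\alpha+1)$. Then with probability at least $1-\delta$ over the i.i.d. sample $\mathcal S$, $$\mathcal R_{\mathcal D}(\hat\Theta)\le \frac{1}{(1-\gamma)^2}\Big(256|A|^5\frac{\|r\|_{\mathcal B}^2}{m}+576\,\gamma^2C_T^2(\Delta t)^2|A|^7\|r\|_{\mathcal B}^2\Big) +\frac{(576\|r\|_{\mathcal B}^2+2)\,|A|^7(\lambda+1)}{(1-\gamma)^2\sqrt n}\Big(72|A|^3\sqrt{2\ln(2d)}+9\ln\Big(4\Big(\tfrac{24}{1-\gamma}|A|^{7/2}\|r\|_{\mathcal B}+1\Big)\Big)+9\ln(|A|/\delta)\Big).$$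
   Context: Residual networks: for positive integers $d,m,D,L$, a residual network of size $(d,m,D,L)$ is a function $f(\cdot,\theta):\mathbb R^d\to\mathbb R$, $f(x,\theta)=u^{\top}h^{[L]}$, where $h^{[0]}=Vx$ and $h^{[l]}=h^{[l-1]}+U^{[l]}\sigma(W^{[l]}h^{[l-1]})$ for $l=1,\dots,L$, with $V\in\mathbb R^{D\times d}$, $W^{[l]}\in\mathbb R^{m\times D}$, $U^{[l]}\in\mathbb R^{D\times m}$, $u\in\mathbb R^D$, $\sigma(z)=\max(z,0)$ applied entrywise, and $\theta=(u,V,\{W^{[l]}\}_{l=1}^L,\{U^{[l]}\}_{l=1}^L)$. Its weighted path norm is $\|\theta\|_{\mathcal P}=\big\||u|^{\top}(I+3|U^{[L]}||W^{[L]}|)\cdots(I+3|U^{[1]}||W^{[1]}|)|V|\big\|_1$, where $|\cdot|$ of a matrix/vector is entrywise absolute value and $I$ is the $D\times D$ identity. For a family $\Theta=\{\theta(a)\}_{a\in A}$ of parameters (one network per action, all of the same size), $f(s,\theta(a))$ denotes the $a$-th network and $\|\Theta\|_{\mathcal P}=\sum_{a\in A}\|\theta(a)\|_{\mathcal P}$. Barron space: for a compact $S\subset\mathbb R^d$, $h:S\to\mathbb R$ is in the Barron space $\mathcal B(S)$ if there is a probability measure $\rho$ on $\mathbb R\times\mathbb R^d$ with $h(x)=\mathbb E_{(u,w)\sim\rho}[u\,\sigma(w^{\top}x)]$ for all $x\in S$; its Barron norm is $\|h\|_{\mathcal B}=\inf_\rho(\mathbb E_{\rho}[u^2\|w\|_1^2])^{1/2}$,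 the infimum over all such $\rho$. For $r:S\times A\to\mathbb R$ with each $r(\cdot,a)\in\mathcal B(S)$, $\|r\|_{\mathcal B}=(\sum_{a\in A}\|r(\cdot,a)\|_{\mathcal B}^2)^{1/2}$. Setting: $S\subseteq[0,1]^d$ is compact with positive Lebesgue measure (state space); $A$ is a finite action set with $|A|=2^{\alpha}$, $\alpha\ge 0$ an integer, identified with $\{1,\dots,2^\alpha\}$; $\gamma\in(0,1)$. The reward $r:S\times A\to\mathbb R$ satisfies: each $r(\cdot,a)$ is continuous and lies in $\mathcal B(S)$, and $|r(s,a)|\le 1$ for all $(s,a)$. The transition $\tilde g:S\times A\times[0,\infty)\to S$ satisfies $\tilde g(s,a,0)=s$, $\tilde g(\tilde g(s,a,t),a,t')=\tilde g(s,a,t+t')$ for $t,t'\ge0$, and there is $C_T>0$ with $\|\tilde g(s,a,t)-\tilde g(s,a,t+\Delta)\|_\infty\le C_T\Delta$ for all $s\in S,a\in A,t\ge0,\Delta\in(0,1)$. A time step $\Delta t\in(0,1)$ is fixed. $\mathcal D$ is the uniform distribution on $S$ and $\mathcal U$ the uniform distribution on $A$. Losses: the Bellman optimal loss is $\mathcal R_{\mathcal D}(\Theta)=\frac12\mathbb E_{s\sim\mathcal D,a\sim\mathcal U}\big(f(s,\theta(a))-r(s,a)-\gamma\max_{a'\in A}f(s',\theta(a'))\big)^2$ with $s'=\tilde g(s,a,\Delta t)$. A sample $\mathcal S=\{(s_i,a_i,s_i')\}_{i=1}^n$ consists of i.i.d. pairs $s_i\sim\mathcal D$, $a_i\sim\mathcal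 U$ (independent) with $s_i'=\tilde g(s_i,a_i,\Delta t)$; the empirical loss is $\mathcal R_{\mathcal S}(\Theta)=\frac1{2n}\sum_{i=1}^n\big(f(s_i,\theta(a_i))-r(s_i,a_i)-\gamma\max_{a'\in A}f(s_i',\theta(a'))\big)^2$. *)

(* Defs.v *)
From HB Require Import structures.
From mathcomp Require Import all_boot all_order all_algebra.
From mathcomp Require Import all_classical all_reals all_analysis.
Set Implicit Arguments.
Unset Strict Implicit.
Unset Printing Implicit Defensive.
Import Order.TTheory GRing.Theory Num.Theory numFieldNormedType.Exports.
Local Open Scope classical_set_scope.
Local Open Scope ring_scope.

Definition relu (R : realType) (z : R) : R := Num.max z 0.
Definition relu_mx (R : realType) (p q : nat) (A : 'M[R]_(p, q)) : 'M[R]_(p, q) :=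
  map_mx (@relu R) A.
Definition abs_mx (R : realType) (p q : nat) (A : 'M[R]_(p, q)) : 'M[R]_(p, q) :=
  map_mx (fun x : R => `|x|) A.

(* Parameters theta = (u, V, {W^[l]}, {U^[l]}) of a residual network of size
   (d, m, D, L); layer l = 1..L is indexed by the ordinal l-1 : 'I_L. *)
Record resnet_param (R : realType) (d m D L : nat) := ResnetParam {
  rn_u : 'cV[R]_D;
  rn_V : 'M[R]_(D, d);
  rn_W : 'I_L -> 'M[R]_(m, D);
  rn_U : 'I_L -> 'M[R]_(D, m) }.

Definition resnet_hidden (R : realType) (d m D L : nat)
    (th : resnet_param R d m D L) (x : 'rV[R]_d) : 'cV[R]_D :=
  foldl (fun h (l : 'I_L) => h + rn_U th l *m relu_mx (rn_W th l *m h))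
        (rn_V th *m x^T) (enum 'I_L).

Definition resnet (R : realType) (d m D L : nat)
    (th : resnet_param R d m D L) (x : 'rV[R]_d) : R :=
  ((rn_u th)^T *m resnet_hidden th x) 0 0.

Definition path_prod (R : realType) (d m D L : nat)
    (th : resnet_param R d m D L) : 'M[R]_D :=
  foldl (fun P (l : 'I_L) =>
           (1%:M + 3%:R *: (abs_mx (rn_U th l) *m abs_mx (rn_W th l))) *m P)
        1%:M (enum 'I_L).

Definition path_norm (R : realType) (d m D L : nat)
    (th : resnet_param R d m D L) : R :=
  \sum_(j < d) `| ((abs_mx (rn_u th))^T *m path_prod th *m abs_mx (rn_V th)) 0 j |.

(* A family Theta = {theta(a)}_{a in A}, A = {1..2^alpha} ~ 'I_(2^alpha) *)
Definition family_path_norm (R : realType) (K d m D L : nat)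
    (Th : 'I_K -> resnet_param R d m D L) : R :=
  \sum_(a < K) path_norm (Th a).

Lemma two_pow_gt0 (alpha : nat) : (0 < 2 ^ alpha)%N.
Proof. by rewrite expn_gt0. Qed.

Definition act0 (alpha : nat) : 'I_(2 ^ alpha) := Ordinal (two_pow_gt0 alpha).

Definition max_act (R : realType) (alpha : nat) (F : 'I_(2 ^ alpha) -> R) : R :=
  \big[Num.max/F (act0 alpha)]_(a < 2 ^ alpha) F a.

Definition bellman_res (R : realType) (alpha d m D L : nat)
    (r : 'rV[R]_d -> 'I_(2 ^ alpha) -> R)
    (g : 'rV[R]_d -> 'I_(2 ^ alpha) -> R -> 'rV[R]_d) (gamma dt : R)
    (Th : 'I_(2 ^ alpha) -> resnet_param R d m D L)
    (s : 'rV[R]_d) (a : 'I_(2 ^ alpha)) : R :=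
  resnet (Th a) s - r s a
  - gamma * max_act (fun a' => resnet (Th a') (g s a dt)).

Definition emp_loss (R : realType) (alpha d m D L n : nat)
    (r : 'rV[R]_d -> 'I_(2 ^ alpha) -> R)
    (g : 'rV[R]_d -> 'I_(2 ^ alpha) -> R -> 'rV[R]_d) (gamma dt : R)
    (ss : 'I_n -> 'rV[R]_d) (aa : 'I_n -> 'I_(2 ^ alpha))
    (Th : 'I_(2 ^ alpha) -> resnet_param R d m D L) : R :=
  (2 * n%:R)^-1 * \sum_(i < n) (bellman_res r g gamma dt Th (ss i) (aa i)) ^+ 2.

Definition reg_obj (R : realType) (alpha d m D L n : nat)
    (r : 'rV[R]_d -> 'I_(2 ^ alpha) -> R)
    (g : 'rV[R]_d -> 'I_(2 ^ alpha) -> R -> 'rV[R]_d) (gamma dt lam : R)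
    (ss : 'I_n -> 'rV[R]_d) (aa : 'I_n -> 'I_(2 ^ alpha))
    (Th : 'I_(2 ^ alpha) -> resnet_param R d m D L) : R :=
  emp_loss r g gamma dt ss aa Th
  + lam / Num.sqrt n%:R * (family_path_norm Th) ^+ 2
    * ln (4 * (family_path_norm Th + 1)).

(* Lebesgue measure / integral on R^d, as iterated one-dimensional
   Lebesgue integrals (Tonelli; used only for nonnegative integrands). *)
Fixpoint iter_leb (R : realType) (k : nat) (F : (nat -> R) -> \bar R)
    (y : nat -> R) : \bar R :=
  match k with
  | 0 => F y
  | k'.+1 => (\int[@lebesgue_measure R]_t
                 iter_leb k' F (fun j => if j == k' then t else y j))%E
  end.

Definition leb_int (R : realType) (d : nat) (F : 'rV[R]_d -> \bar R) : \bar R :=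
  iter_leb d (fun y => F (\row_(i < d) y i)) (fun _ => 0).

Definition leb_vol (R : realType) (d : nat) (B : set 'rV[R]_d) : \bar R :=
  leb_int (fun x => (\1_B x)%:E).

(* Borel sets of R^d: preimages of measurable sets of d.-tuple R (product
   sigma-algebra of the Borel sets of R, = Borel sets of R^d). *)
Definition rv2t (R : realType) (d : nat) (x : 'rV[R]_d) : d.-tuple R :=
  [tuple x ord0 i | i < d].

Definition rV_measurable (R : realType) (d : nat) (B : set 'rV[R]_d) : Prop :=
  exists B' : set (d.-tuple R), measurable B' /\ B = (@rv2t R d) @^-1` B'.

Definition unif_prob (R : realType) (d : nat) (S : set 'rV[R]_d)
    (B : set 'rV[R]_d) : \bar R :=
  ((fine (leb_vol S))^-1)%:E * leb_vol (B `&` S).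

Definition unif_expect (R : realType) (d : nat) (S : set 'rV[R]_d)
    (phi : 'rV[R]_d -> R) : \bar R :=
  ((fine (leb_vol S))^-1)%:E * leb_int (fun x => (\1_S x * phi x)%:E).

Definition pop_loss (R : realType) (alpha d m D L : nat) (S : set 'rV[R]_d)
    (r : 'rV[R]_d -> 'I_(2 ^ alpha) -> R)
    (g : 'rV[R]_d -> 'I_(2 ^ alpha) -> R -> 'rV[R]_d) (gamma dt : R)
    (Th : 'I_(2 ^ alpha) -> resnet_param R d m D L) : \bar R :=
  (\sum_(a < 2 ^ alpha)
     (((2 ^ alpha)%:R)^-1)%:E *
       unif_expect S (fun s => ((bellman_res r g gamma dt Th s a) ^+ 2 / 2)%R))%E.

Definition dotw (R : realType) (d : nat) (w : d.-tuple R) (x : 'rV[R]_d) : R :=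
  \sum_(i < d) tnth w i * x ord0 i.

Definition l1_tuple (R : realType) (d : nat) (w : d.-tuple R) : R :=
  \sum_(i < d) `|tnth w i|.

Definition barron_rep (R : realType) (d : nat) (S : set 'rV[R]_d)
    (h : 'rV[R]_d -> R) (rho : probability (R * d.-tuple R)%type R) : Prop :=
  forall x, S x ->
    rho.-integrable setT (fun z : R * d.-tuple R => (z.1 * relu (dotw z.2 x))%:E)
    /\ (\int[rho]_z (z.1 * relu (dotw z.2 x))%:E)%E = (h x)%:E.

Definition barron_space (R : realType) (d : nat) (S : set 'rV[R]_d)
    (h : 'rV[R]_d -> R) : Prop :=
  exists rho, barron_rep S h rho.

Definition barron_sq (R : realType) (d : nat) (S : set 'rV[R]_d)
    (h : 'rV[R]_d -> R) : \bar R :=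
  ereal_inf [set (\int[rho]_z ((z.1 ^+ 2 * l1_tuple z.2 ^+ 2)%:E))%E
            | rho in [set rho | barron_rep S h rho]].

Definition linf (R : realType) (d : nat) (x : 'rV[R]_d) : R :=
  \big[Num.max/0]_(i < d) `|x ord0 i|.

Definition iid_sample (R : realType) (alpha d n : nat) (S : set 'rV[R]_d)
    (dO : measure_display) (O : measurableType dO) (P : probability O R)
    (s : 'I_n -> O -> 'rV[R]_d) (a : 'I_n -> O -> 'I_(2 ^ alpha)) : Prop :=
  [/\ (forall i B, rV_measurable B -> measurable (s i @^-1` B)),
      (forall i (C : set 'I_(2 ^ alpha)), measurable (a i @^-1` C)),
      (forall i B, rV_measurable B -> P (s i @^-1` B) = unif_prob S B),
      (forall i (b : 'I_(2 ^ alpha)),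
          P (a i @^-1` [set b]) = (((2 ^ alpha)%:R)^-1)%:E) &
      (forall (B : 'I_n -> set 'rV[R]_d) (C : 'I_n -> set 'I_(2 ^ alpha)),
          (forall i, rV_measurable (B i)) ->
          P (\bigcap_i (s i @^-1` B i `&` a i @^-1` C i)) =
          (\prod_(i < n) (P (s i @^-1` B i) * P (a i @^-1` C i)))%E)].

(* Main.v *)
(** The regularization term only has to dominate a deviation bound of the form
    pop <= emp + (3 Lambda + 1)^2 lambda / sqrt n, uniform over all families of
    path norm Lambda: comparing the minimizer with one explicit family then gives
    the theorem, because (3 Lambda + 1)^2 <= 18 Lambda^2 + 2 and
    ln (4 (Lambda + 1)) >= 1.

    Comparison family.  It may depend on the sample.  The rewards are replaced by
    m-term Monte Carlo approximations r_m, selected one neuron at a time, and one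
    takes f(., a) = r_m(., a) + gamma / (1 - gamma) max_b r_m(., b), the maximum
    being computed by a knock-out tournament in the last alpha layers.  Its Bellman
    residual is (r_m - r)(s, a) + gamma / (1 - gamma) (max r_m(s, .) - max r_m(s', .)),
    where |s - s'| <= C_T dt.

    Deviation bound.  Dividing residuals by 3 Lambda + 1 puts all of them, whatever
    Lambda, into one set obtained from finitely many vectors (coordinates and
    rewards) by taking hulls and applying relu, absolute value and indicators of
    actions.  An exponential moment bound for the Rademacher process survives each
    such step at the cost of a factor 3 (contraction principle), which only enters
    logarithmically.  Symmetrization is done on a finite probability space, after
    partitioning the state space into cells on which all scaled losses are nearly
    constant; no measurability of suprema over networks is then needed. *)

Require Import Defs.
From HB Require Import structures.
From mathcomp Require Import all_boot all_order all_algebra.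
From mathcomp Require Import all_classical all_reals all_analysis.
From mathcomp Require Import measurable_realfun ring lra zify.
Import Order.TTheory GRing.Theory Num.Theory numFieldNormedType.Exports.
Set Implicit Arguments.
Unset Strict Implicit.
Unset Printing Implicit Defensive.
Local Open Scope classical_set_scope.
Local Open Scope ring_scope.

(** * Elementary inequalities *)

(** With c = gamma / (1 - gamma), the family f = r + c max r has max f = (1 + c) max r, and gamma (1
    + c) = c, so the Bellman equation holds up to the displacement term c (max r(s) - max r(s')).
    Since the minimizer is compared with a competitor on the very sample drawn, the competitor only
    has to be accurate at the sample points, its population loss never occurs, and the deviation
    bound is needed in one direction only. Suprema over networks are replaced throughout by choice
    functions. Symmetrization with a ghost sample turns a sample-dependent parameter into a
    sign-dependent one, which is exactly the freedom granted by [rad_bound]. The same freedom is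
    what makes the contraction principle provable one coordinate at a time, by picking for each pair
    of opposite signs one of finitely many replacements. *)

Lemma expR_le_invB1 (R : realType) (x : R) : x < 1 -> expR x <= (1 - x)^-1.
Proof.
move=> x1; have x1' : 0 < 1 - x by rewrite subr_gt0.
rewrite -[expR x]invrK lef_pV2 ?posrE ?invr_gt0 ?expR_gt0// -expRN.
exact: expR_ge1Dx.
Qed.

(** The sharp exponent is [x ^+ 2 / 2]; the weaker one keeps the proof elementary. For
    [x ^+ 2 <= 4^-1] the left side is at most [2 / (1 - x ^+ 2)], and otherwise
    [|x| <= 2 * x ^+ 2]. *)
Lemma cosh_le_gauss (R : realType) (x : R) :
  expR x + expR (- x) <= 2 * expR (2 * x ^+ 2).
Proof.
have [x2|x2] := leP (x ^+ 2) (4^-1).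
  have x1 : x < 1 by nra.
  have Nx1 : - x < 1 by nra.
  have y0 : 0 < 1 - x ^+ 2 by lra.
  apply: (@le_trans _ _ (2 * (1 - x ^+ 2)^-1)).
    have -> : 2 * (1 - x ^+ 2)^-1 = (1 - x)^-1 + (1 - - x)^-1.
      field; apply/and3P; split; apply/eqP => h; nra.
    by rewrite lerD// expR_le_invB1.
  rewrite ler_pM2l// -[leLHS]div1r ler_pdivrMr//.
  apply: (@le_trans _ _ ((1 + 2 * x ^+ 2) * (1 - x ^+ 2))); first by nra.
  by rewrite ler_pM2r// expR_ge1Dx.
have h y : y ^+ 2 = x ^+ 2 -> expR y <= expR (2 * x ^+ 2).
  by move=> yx; rewrite ler_expR -yx; rewrite -yx in x2; nra.
have := h x erefl; have := h (- x) (sqrrN x); lra.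
Qed.

Lemma ler_cosh (R : realType) (g y : R) : `|g| <= y ->
  expR g + expR (- g) <= expR y + expR (- y).
Proof.
move=> gy.
have -> : expR g + expR (- g) = expR `|g| + expR (- `|g|).
  by case: (ger0P g) => // _; rewrite opprK addrC.
have u1 : 1 <= expR `|g| by rewrite -expR0 ler_expR.
have uv : expR `|g| <= expR y by rewrite ler_expR.
rewrite !expRN; move: (expR `|g|) (expR y) u1 uv => u v u1 uv.
have u0 : 0 < u by lra.
have v0 : 0 < v by lra.
have -> : v + v^-1 = u + u^-1 + (v - u) * (1 - (u * v)^-1).
  by field; rewrite !gt_eqF.
rewrite lerDl mulr_ge0 ?subr_ge0// invf_le1 ?mulr_gt0//; nra.
Qed.

(** If [p * expR f <= q * expR g], monotonicity of cosh gives the second alternative. Otherwise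
    replacing [- y] by [- g] gains at most [q * expR g * (expR (y - g) - 1)], while replacing [x] by
    [f] loses at least [p * expR f * (expR (y - g) - 1)], because [f + y - g <= x]. *)
Lemma contraction_pair_ge0 (R : realType) (p q x y f g : R) :
  0 < p -> 0 < q -> 0 <= y <= x -> `|f| <= x -> `|g| <= y -> `|f - g| <= x - y ->
  p * expR f + q * expR (- g) <= p * expR x + q * expR (- y) \/
  p * expR f + q * expR (- g) <= q * expR y + q * expR (- y).
Proof.
move=> p0 q0 /andP[y0 yx] fx gy fg.
have cosh_gy := ler_cosh gy.
have [pq|pq] := leP (p * expR f) (q * expR g); [right|left].
  by rewrite (le_trans (lerD pq (lexx _)))// -!mulrDr ler_pM2l.
have xf : expR f * expR (y - g) <= expR x.
  rewrite -expRD ler_expR; have := ler_norm (f - g); lra.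
have s1 : 1 <= expR (y - g).
  by rewrite -expR0 ler_expR subr_ge0 (le_trans (ler_norm _) gy).
have eyg : expR y = expR g * expR (y - g) by rewrite -expRD; congr expR; lra.
have h1 : q * (expR y - expR g) <= p * (expR x - expR f).
  apply: (@le_trans _ _ (p * expR f * (expR (y - g) - 1))); last first.
    by rewrite -mulrA ler_pM2l// mulrBr mulr1 lerD2r.
  have -> : q * (expR y - expR g) = q * expR g * (expR (y - g) - 1).
    by rewrite eyg; ring.
  by rewrite ler_wpM2r ?subr_ge0// ltW.
have h2 : q * (expR (- g) - expR (- y)) <= q * (expR y - expR g).
  by rewrite ler_pM2l//; lra.
lra.
Qed.

(* The combinatorial core of the Ledoux-Talagrand contraction principle for exp:
   [p], [q] are the exponentials of the part of the sum not involving the current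
   sign, [x], [y] the current coordinates and [f], [g] their contracted images. *)
Lemma contraction_pair (R : realType) (p q x y f g : R) :
  0 < p -> 0 < q -> `|f| <= `|x| -> `|g| <= `|y| -> `|f - g| <= `|x - y| ->
  [\/ p * expR f + q * expR (- g) <= p * expR x + q * expR (- y),
      p * expR f + q * expR (- g) <= q * expR y + p * expR (- x),
      p * expR f + q * expR (- g) <= p * expR x + p * expR (- x) |
      p * expR f + q * expR (- g) <= q * expR y + q * expR (- y)].
Proof.
move=> p0 q0 fx gy fg.
have Ef := fx; have Eg := gy; rewrite !ler_norml in Ef Eg.
have le_pq (a b c e : R) : a <= c -> b <= e ->
    p * expR a + q * expR b <= p * expR c + q * expR e.
  by move=> ac be; rewrite lerD// ler_pM2l// ler_expR.
have gf : `|- g - - f| <= `|y - x| by rewrite opprK addrC (distrC y).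
case: (lerP 0 x) => x0; case: (lerP 0 y) => y0.
- rewrite (ger0_norm x0) in fx; rewrite (ger0_norm y0) in gy.
  have [yx|xy] := leP y x.
    rewrite (@ger0_norm _ (x - y)) ?subr_ge0// in fg.
    have yx0 : 0 <= y <= x by rewrite y0.
    by have [h|h] := contraction_pair_ge0 p0 q0 yx0 fx gy fg;
       [constructor 1|constructor 4].
  rewrite (@ger0_norm _ (y - x)) ?subr_ge0 ?(ltW xy)// in gf.
  have xy0 : 0 <= x <= y by rewrite x0 ltW.
  rewrite -normrN in fx; rewrite -normrN in gy.
  have [h|h] := contraction_pair_ge0 q0 p0 xy0 gy fx gf.
    by constructor 2; move: h; rewrite opprK addrC.
  by constructor 3; move: h; rewrite opprK addrC.
- by constructor 1; apply: le_pq; move: Ef Eg;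
    rewrite (ger0_norm x0) (ltr0_norm y0) => /andP[? ?] /andP[? ?]; lra.
- by constructor 2; rewrite [leRHS]addrC; apply: le_pq; move: Ef Eg;
    rewrite (ltr0_norm x0) (ger0_norm y0) => /andP[? ?] /andP[? ?]; lra.
- rewrite (ltr0_norm x0) in fx; rewrite (ltr0_norm y0) in gy.
  have [xy|yx] := leP x y.
    have fg' : `|f - g| <= - x - - y by move: fg; rewrite (@ler0_norm _ (x - y)) ?subr_le0//; lra.
    have xy0 : 0 <= - y <= - x by rewrite oppr_ge0 (ltW y0) lerN2.
    have [h|h] := contraction_pair_ge0 p0 q0 xy0 fx gy fg'.
    + by constructor 2; move: h; rewrite opprK [X in _ <= X -> _]addrC.
    + by constructor 4; move: h; rewrite opprK [X in _ <= X -> _]addrC.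
  have gf' : `|- g - - f| <= - y - - x.
    by move: gf; rewrite (@ler0_norm _ (y - x)) ?subr_le0 ?(ltW yx)//; lra.
  rewrite -normrN in fx; rewrite -normrN in gy.
  have yx0 : 0 <= - x <= - y by rewrite oppr_ge0 (ltW x0) lerN2 (ltW yx).
  have [h|h] := contraction_pair_ge0 q0 p0 yx0 gy fx gf'.
  + by constructor 1; move: h; rewrite !opprK addrC [X in _ <= X -> _]addrC.
  + by constructor 3; move: h; rewrite !opprK addrC [X in _ <= X -> _]addrC.
Qed.

(** * Rademacher exponential moments *)

Section Rademacher.
Context {R : realType} {n : nat}.
Implicit Types (e : {ffun 'I_n -> bool}) (v w : 'I_n -> R) (V W : set ('I_n -> R)).

Definition sgnsum e v : R := \sum_i (-1) ^+ e i * v i.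

(* Exponential moment bound for the Rademacher process indexed by [V]: the supremum
   over [V] is replaced by an arbitrary sign-dependent choice of an element of [V],
   so that neither boundedness nor attainment is an issue. *)
Definition rad_bound (tau : R) V (B : R) := forall v : {ffun 'I_n -> bool} -> 'I_n -> R,
  (forall e, V (v e)) -> \sum_e expR (tau * sgnsum e (v e)) <= 2 ^+ n * B.

Definition flip_all e : {ffun 'I_n -> bool} := [ffun i => ~~ e i].

Definition flip_at (k : 'I_n) e : {ffun 'I_n -> bool} :=
  [ffun i => if i == k then ~~ e i else e i].

Lemma flip_allK : involutive flip_all.
Proof. by move=> e; apply/ffunP => i; rewrite !ffunE negbK. Qed.

Lemma flip_atK k : involutive (flip_at k).
Proof. by move=> e; apply/ffunP => i; rewrite !ffunE; case: eqP => // _; rewrite negbK. Qed.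

Lemma sgnsum_flip_all e v : sgnsum (flip_all e) v = - sgnsum e v.
Proof.
by rewrite /sgnsum -sumrN; apply: eq_bigr => i _; rewrite ffunE signrN mulNr.
Qed.

Lemma sgnsumN e v : sgnsum e (fun i => - v i) = - sgnsum e v.
Proof. by rewrite /sgnsum -sumrN; apply: eq_bigr => i _; rewrite mulrN. Qed.

Lemma sgnsumD e v w : sgnsum e (fun i => v i + w i) = sgnsum e v + sgnsum e w.
Proof. by rewrite /sgnsum -big_split; apply: eq_bigr => i _; rewrite mulrDr. Qed.

Lemma sgnsumZ e (c : R) v : sgnsum e (fun i => c * v i) = c * sgnsum e v.
Proof. by rewrite /sgnsum mulr_sumr; apply: eq_bigr => i _; rewrite mulrCA. Qed.

Lemma sum_signs_pair (k : 'I_n) (F : {ffun 'I_n -> bool} -> R) :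
  \sum_e F e = \sum_(e : {ffun 'I_n -> bool} | ~~ e k) (F e + F (flip_at k e)).
Proof.
rewrite (bigID (fun e : {ffun 'I_n -> bool} => e k)) /= addrC big_split /=; congr (_ + _).
rewrite (reindex_inj (inv_inj (flip_atK k))) /=.
by apply: eq_bigl => e; rewrite ffunE eqxx.
Qed.

Lemma rad_bound_set1 tau v : (forall i, `|v i| <= 1) ->
  rad_bound tau [set v] (expR (2 * tau ^+ 2 * n%:R)).
Proof.
move=> v1 w wv.
have -> : \sum_e expR (tau * sgnsum e (w e)) =
    \sum_(e : {ffun 'I_n -> bool}) \prod_i expR (tau * ((-1) ^+ e i * v i)).
  by apply: eq_bigr => e _; rewrite -expR_sum -mulr_sumr (wv e).
rewrite -(bigA_distr_bigA (fun i (b : bool) => expR (tau * ((-1) ^+ b * v i)))).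
have -> : 2 ^+ n * expR (2 * tau ^+ 2 * n%:R) =
    \prod_(i < n) (2 * expR (2 * tau ^+ 2)).
  by rewrite prodr_const card_ord exprMn expRM_natr.
apply: ler_prod => i _; rewrite big_bool /= expr0 expr1.
rewrite addr_ge0 ?expR_ge0//= mul1r mulN1r mulrN addrC.
rewrite (le_trans (cosh_le_gauss _))// ler_pM2l// ler_expR exprMn ler_pM2l//.
by rewrite -[leRHS]mulr1 ler_wpM2l ?sqr_ge0// -real_normK ?num_real// expr_le1.
Qed.

(** The exponential of a maximum is at most the sum of the exponentials. A choice from the union is
    split in two, each padded with a fixed element wherever it would leave its set. *)
Lemma rad_boundU tau V W B C : V !=set0 -> W !=set0 ->
  rad_bound tau V B -> rad_bound tau W C -> rad_bound tau (V `|` W) (B + C).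
Proof.
move=> [v0 Vv0] [w0 Ww0] VB WC u VWu.
pose v e := if `[< V (u e) >] then u e else v0.
pose w e := if `[< V (u e) >] then w0 else u e.
have Vv e : V (v e) by rewrite /v; case: asboolP.
have Ww e : W (w e) by rewrite /w; case: asboolP => // h; case: (VWu e).
rewrite mulrDr (le_trans _ (lerD (VB _ Vv) (WC _ Ww)))// -big_split.
apply: ler_sum => e _; rewrite /v /w; case: asboolP => _.
  by rewrite lerDl expR_ge0.
by rewrite lerDr expR_ge0.
Qed.

Lemma rad_bound_opp tau V B : rad_bound tau V B ->
  rad_bound tau ((fun v i => - v i) @` V) B.
Proof.
move=> VB w Vw; have /choice[v hv] e : exists v, V v /\ (fun i => - v i) = w (flip_all e).
  by have [v Vv <-] := Vw (flip_all e); exists v.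
have := VB v (fun e => (hv e).1); congr (_ <= _).
rewrite (reindex_inj (inv_inj flip_allK)); apply: eq_bigr => e _.
have -> : w e = (fun i => - v (flip_all e) i) by rewrite (hv _).2 flip_allK.
by rewrite sgnsumN sgnsum_flip_all.
Qed.

(** Only signed sums enter [rad_bound], so convexity is tested in these directions alone. For
    [c >= 0] the set contains all [c]-multiples of convex combinations of [V], and the witness may
    change with the signs. *)
Definition hull (c : R) V : set ('I_n -> R) :=
  [set w | forall e, exists2 v, V v & sgnsum e w <= c * sgnsum e v].

Lemma rad_bound_hull tau V B : 0 <= tau -> rad_bound tau V B ->
  rad_bound tau (hull 1 V) B.
Proof.
move=> tau0 VB w Vw; have /choice[v hv] e : exists v, V v /\ sgnsum e (w e) <= sgnsum e v.
  by have [v] := Vw e e; rewrite mul1r; exists v.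
rewrite (le_trans _ (VB v (fun e => (hv e).1)))//; apply: ler_sum => e _.
by rewrite ler_expR ler_wpM2l// (hv e).2.
Qed.

(** Hybrid argument: [H k v] keeps [v] on the coordinates below [k] and uses [G v] from [k] on. [G]
    acts on vectors of [V] so that maps contracting only on a bounded range, such as squaring, are
    covered. *)
Lemma rad_bound_contraction tau V B (G : ('I_n -> R) -> 'I_n -> R) : 0 <= tau ->
  (forall v i, V v -> `|G v i| <= `|v i|) ->
  (forall v w i, V v -> V w -> `|G v i - G w i| <= `|v i - w i|) ->
  rad_bound tau V B -> rad_bound tau (G @` V) B.
Proof.
move=> tau0 G0 Glip VB.
pose H k v (i : 'I_n) := if (i < k)%N then v i else G v i.
suff hyb k (v : {ffun 'I_n -> bool} -> 'I_n -> R) : (k <= n)%N -> (forall e, V (v e)) ->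
    \sum_e expR (tau * sgnsum e (H (n - k)%N (v e))) <= 2 ^+ n * B.
  move=> w Vw; have /choice[v hv] e : exists v, V v /\ G v = w e.
    by have [v Vv <-] := Vw e; exists v.
  have := hyb n v (leqnn _) (fun e => (hv e).1); congr (_ <= _).
  by apply: eq_bigr => e _; rewrite subnn -(hv e).2.
elim: k v => [|k IH] v kn Vv.
  have := VB v Vv; congr (_ <= _); apply: eq_bigr => e _; congr (expR (_ * _)).
  by apply: eq_bigr => i _; rewrite /H subn0 ltn_ord.
have kn' : (n - k.+1 < n)%N by rewrite -subn_gt0 subKn.
pose i0 := Ordinal kn'.
have Sk : (n - k = (n - k.+1).+1)%N by rewrite -subSn.
(* This part of the signed sum does not see the sign at [i0]; its exponentials at [v e] and [v e']
   become the factors [p] and [q] of [contraction_pair]. *)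
pose rest e u := \sum_(i < n | i != i0) (-1) ^+ e i * H (n - k)%N u i.
have restf e u : rest (flip_at i0 e) u = rest e u.
  by apply: eq_bigr => i /negPf ii0; rewrite ffunE ii0.
have sgn1 e u : sgnsum e (H (n - k)%N u) = rest e u + (-1) ^+ e i0 * u i0.
  rewrite /sgnsum (bigD1 i0)//= addrC; congr (_ + _).
  by rewrite /H Sk /= leqnn.
have sgn2 e u : sgnsum e (H (n - k.+1)%N u) = rest e u + (-1) ^+ e i0 * G u i0.
  rewrite /sgnsum (bigD1 i0)//= addrC /H /= ltnn; congr (_ + _).
  apply: eq_bigr => i ii0; rewrite /H.
  by have -> : (i < n - k)%N = (i < n - k.+1)%N
    by rewrite Sk ltnS [LHS]leq_eqVlt -[_ == _]/(i == i0) (negbTE ii0).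
(* Each alternative of [contraction_pair] tells which of [v e] and [v e'] to use for either sign at
   [i0]. *)
have /choice[W hW] e : exists W : ('I_n -> R) * ('I_n -> R), [/\ V W.1, V W.2 &
   ~~ e i0 -> expR (tau * sgnsum e (H (n - k.+1)%N (v e)))
     + expR (tau * sgnsum (flip_at i0 e) (H (n - k.+1)%N (v (flip_at i0 e)))) <=
   expR (tau * sgnsum e (H (n - k)%N W.1))
     + expR (tau * sgnsum (flip_at i0 e) (H (n - k)%N W.2))].
  case e0 : (e i0); first by exists (v e, v e); split=> //; exact: Vv.
  set e' := flip_at i0 e.
  have fe0 : e' i0 = true by rewrite /e' ffunE eqxx e0.
  have expE u : expR (tau * sgnsum e (H (n - k)%N u)) =
       expR (tau * rest e u) * expR (tau * u i0).
    by rewrite sgn1 e0 mul1r mulrDr expRD.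
  have expE' u : expR (tau * sgnsum e' (H (n - k)%N u)) =
       expR (tau * rest e u) * expR (- (tau * u i0)).
    by rewrite sgn1 fe0 mulN1r mulrDr expRD restf mulrN.
  rewrite sgn2 e0 mul1r sgn2 fe0 mulN1r !mulrDr !expRD restf mulrN.
  have nM u u' : `|u| <= `|u'| -> `|tau * u| <= `|tau * u'|.
    by move=> uu'; rewrite !normrM ler_wpM2l.
  have := contraction_pair (expR_gt0 (tau * rest e (v e)))
    (expR_gt0 (tau * rest e (v e'))) (nM _ _ (G0 _ i0 (Vv e)))
    (nM _ _ (G0 _ i0 (Vv e'))).
  rewrite -!mulrBr => /(_ (nM _ _ (Glip _ _ i0 (Vv e) (Vv e')))) [] h.
  - by exists (v e, v e'); (split=> [||_]; [exact: Vv|exact: Vv|by rewrite expE expE']).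
  - by exists (v e', v e); (split=> [||_]; [exact: Vv|exact: Vv|by rewrite expE expE']).
  - by exists (v e, v e); (split=> [||_]; [exact: Vv|exact: Vv|by rewrite expE expE']).
  - by exists (v e', v e'); (split=> [||_]; [exact: Vv|exact: Vv|by rewrite expE expE']).
(* The pairs are merged into one choice function; [W] is always read at the member of the pair whose
   sign bit at [i0] is false. *)
pose u e := if e i0 then (W (flip_at i0 e)).2 else (W e).1.
have Vu e : V (u e) by rewrite /u; case: ifP => _; have [] := hW (flip_at i0 e); have [] := hW e.
rewrite (le_trans _ (IH u (ltnW kn) Vu))//.
rewrite (sum_signs_pair i0) [leRHS](sum_signs_pair i0); apply: ler_sum => e e0.
have [_ _ /(_ e0)] := hW e.
by rewrite /u (negbTE e0) ffunE eqxx e0 flip_atK.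
Qed.

End Rademacher.

(** * Hulls and their closure under contractions *)

Section Hull.
Context {R : realType} {n : nat}.
Implicit Types (e : {ffun 'I_n -> bool}) (v w : 'I_n -> R) (V W : set ('I_n -> R)).

Definition balanced V := V (fun=> 0) /\ forall v, V v -> V (fun i => - v i).

Lemma hull0 V : balanced V -> hull 0 V (fun=> 0).
Proof.
move=> [V0 _] e; exists (fun=> 0) => //.
by rewrite mul0r /sgnsum big1// => i _; rewrite mulr0.
Qed.

Lemma hull_incl V v : V v -> hull 1 V v.
Proof. by move=> Vv e; exists v; rewrite ?mul1r. Qed.

Lemma hullS c V W : V `<=` W -> hull c V `<=` hull c W.
Proof. by move=> VW w Vw e; have [v Vv ?] := Vw e; exists v => //; exact: VW. Qed.

Lemma hull_le c c' V : balanced V -> 0 <= c <= c' -> hull c V `<=` hull c' V.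
Proof.
move=> [V0 _] /andP[c0 cc'] w Vw e; have [v Vv ew] := Vw e.
have [v0|v0] := leP 0 (sgnsum e v).
  by exists v => //; rewrite (le_trans ew)// ler_wpM2r.
exists (fun=> 0) => //; have -> : sgnsum e (fun=> 0 : R) = 0.
  by rewrite /sgnsum big1// => i _; rewrite mulr0.
by rewrite mulr0 (le_trans ew)// mulr_ge0_le0// ltW.
Qed.

(** For each sign pattern, the one of the two witnesses with the larger signed sum serves both
    summands. *)
Lemma hullD c c' V v w : 0 <= c -> 0 <= c' -> hull c V v -> hull c' V w ->
  hull (c + c') V (fun i => v i + w i).
Proof.
move=> c0 c'0 Vv Vw e; have [v' Vv' ev] := Vv e; have [w' Vw' ew] := Vw e.
rewrite sgnsumD; have [vw|/ltW vw] := leP (sgnsum e v') (sgnsum e w').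
  exists w' => //; rewrite mulrDl lerD// (le_trans ev)//; exact: ler_wpM2l.
exists v' => //; rewrite mulrDl lerD// (le_trans ew)//; exact: ler_wpM2l.
Qed.

Lemma hullZ (k : R) c V v : balanced V -> hull c V v ->
  hull (`|k| * c) V (fun i => k * v i).
Proof.
move=> [_ VN] Vv e; have [k0|k0] := leP 0 k.
  have [w Vw ew] := Vv e; exists w => //.
  by rewrite sgnsumZ ger0_norm// -mulrA ler_wpM2l.
(* For negative [k] the witness is taken at the opposite signs and negated. *)
have [w Vw ew] := Vv (flip_all e).
exists (fun i => - w i); first exact: VN.
rewrite sgnsumZ sgnsumN -mulrA -[k * _]mulrNN (ltr0_norm k0) ler_wpM2l ?oppr_ge0 ?(ltW k0)//.
by move: ew; rewrite !sgnsum_flip_all !mulrN.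
Qed.

Lemma hull_sum (I : Type) (s : seq I) (c : I -> R) V (F : I -> 'I_n -> R) :
  balanced V -> (forall a, 0 <= c a) -> (forall a, hull (c a) V (F a)) ->
  hull (\sum_(a <- s) c a) V (fun i => \sum_(a <- s) F a i).
Proof.
move=> Vb c0 VF; elim: s => [|a s IH].
  by rewrite big_nil; under [X in hull _ _ X]eq_fun do rewrite big_nil; exact: hull0.
rewrite big_cons; under [X in hull _ _ X]eq_fun do rewrite big_cons.
by apply: hullD => //; exact: sumr_ge0.
Qed.

(** All signed sums are nonpositive, hence zero after flipping all signs; two patterns differing
    only at [k] then isolate [w k]. This settles radius 0 in [hull_step], where rescaling is
    impossible. *)
Lemma hull0_eq0 V w : hull 0 V w -> w = fun=> 0.
Proof.
move=> Vw; have le0 e : sgnsum e w <= 0 by have [v _] := Vw e; rewrite mul0r.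
have eq0 e : sgnsum e w = 0.
  by apply/eqP; rewrite eq_le le0 -oppr_le0 -sgnsum_flip_all le0.
apply/funext => k; have := eq0 [ffun=> false]; have := eq0 (flip_at k [ffun=> false]).
rewrite /sgnsum (bigD1 k)//= [X in _ -> X = _ -> _](bigD1 k)//= !ffunE eqxx mulN1r mul1r.
rewrite (eq_bigr (fun i => (-1) ^+ [ffun=> false] i * w i)) => [|i /negPf ik]; first lra.
by rewrite !ffunE ik.
Qed.

(** Positive homogeneity lets a hull of any positive radius be rescaled to radius 1, the one at
    which [step] applies the map. *)
Definition contraction (phi : 'I_n -> R -> R) :=
  (forall i x y, `|phi i x - phi i y| <= `|x - y|) /\
  (forall i c x, 0 <= c -> phi i (c * x) = c * phi i x).

Lemma contraction0 phi i : contraction phi -> phi i 0 = 0.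
Proof. by move=> [_ /(_ i 0 0 (lexx _))]; rewrite !mul0r. Qed.

(** The map is applied to the whole hull of [V], so a single step accounts for arbitrarily many
    units. Keeping [V] and adding the negatives makes the construction balanced, hence iterable; the
    three pieces are the origin of the factor 3. *)
Definition step phi V : set ('I_n -> R) :=
  V `|` ((fun v i => phi i (v i)) @` hull 1 V `|`
         (fun v i => - v i) @` ((fun v i => phi i (v i)) @` hull 1 V)).

Lemma sub_step phi V : V `<=` step phi V.
Proof. by move=> v; left. Qed.

Lemma balanced_step phi V : balanced V -> balanced (step phi V).
Proof.
move=> [V0 VN]; split; first by left.
move=> v [/VN|[Vv|[w Vw <-]]]; [by left|by right; right; exists v|right; left].
by rewrite (_ : (fun i => - - w i) = w)//; apply/funext => i; rewrite opprK.
Qed.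

Lemma hull_step phi c V w : contraction phi -> 0 <= c -> balanced V -> hull c V w ->
  hull c (step phi V) (fun i => phi i (w i)).
Proof.
move=> phiC; rewrite le_eqVlt => /predU1P[<- Vb|c0 Vb] Vw.
  rewrite (hull0_eq0 Vw); under [X in hull _ _ X]eq_fun do rewrite (contraction0 _ phiC).
  exact/hull0/balanced_step.
have Vw' : hull 1 V (fun i => c^-1 * w i).
  have -> : 1 = `|c^-1| * c by rewrite gtr0_norm ?invr_gt0// mulVf ?gt_eqF.
  exact: hullZ.
move=> e; exists (fun i => phi i (c^-1 * w i)).
  by right; left; exists (fun i => c^-1 * w i).
rewrite -sgnsumZ le_eqVlt; apply/orP; left; apply/eqP; congr sgnsum.
by apply/funext => i; rewrite -(phiC.2 i c) ?ltW// mulVKf ?gt_eqF.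
Qed.

Lemma rad_bound_step tau phi V B : 0 <= tau -> contraction phi -> balanced V ->
  rad_bound tau V B -> rad_bound tau (step phi V) (3 * B).
Proof.
move=> tau0 phiC Vb VB.
have h : rad_bound tau ((fun v i => phi i (v i)) @` hull 1 V) B.
  apply: rad_bound_contraction (rad_bound_hull tau0 VB) => //.
    by move=> v i _; have := phiC.1 i (v i) 0; rewrite (contraction0 _ phiC) !subr0.
  by move=> v w i _ _; exact: phiC.1.
have V0 : V !=set0 by exists (fun=> 0); have [] := Vb.
have hV0 : ((fun v i => phi i (v i)) @` hull 1 V) !=set0.
  by case: V0 => v Vv; exists (fun i => phi i (v i)); exists v => //; exact: hull_incl.
have -> : 3 * B = B + (B + B) by ring.
apply: rad_boundU => //; last apply: rad_boundU => //; last exact: rad_bound_opp.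
  by case: hV0 => v hv; exists v; left.
by case: hV0 => v hv; exists (fun i => - v i), v.
Qed.

Lemma balanced_iter_step phi V k : balanced V -> balanced (iter k (step phi) V).
Proof. by move=> Vb; elim: k => //= k; exact: balanced_step. Qed.

Lemma rad_bound_iter tau phi V B k : 0 <= tau -> contraction phi -> balanced V ->
  rad_bound tau V B -> rad_bound tau (iter k (step phi) V) (3 ^+ k * B).
Proof.
move=> tau0 phiC Vb VB; elim: k => /= [|k IH]; first by rewrite mul1r.
by rewrite exprS -mulrA; apply: rad_bound_step => //; exact: balanced_iter_step.
Qed.

Lemma sub_iter_step phi V k : V `<=` iter k (step phi) V.
Proof. by elim: k => //= k IH v /IH; exact: sub_step. Qed.

Lemma balanced_foldr_step (T : Type) (phi : T -> _) s V :
  balanced V -> balanced (foldr (step \o phi) V s).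
Proof. by move=> Vb; elim: s => //= a s; exact: balanced_step. Qed.

Lemma rad_bound_foldr (T : Type) tau (phi : T -> 'I_n -> R -> R) s V B :
  0 <= tau -> (forall a, contraction (phi a)) -> balanced V ->
  rad_bound tau V B -> rad_bound tau (foldr (step \o phi) V s) (3 ^+ size s * B).
Proof.
move=> tau0 phiC Vb VB; elim: s => /= [|a s IH]; first by rewrite mul1r.
by rewrite exprS -mulrA; apply: rad_bound_step => //; exact: balanced_foldr_step.
Qed.

Lemma sub_foldr_step (T : Type) (phi : T -> 'I_n -> R -> R) s V :
  V `<=` foldr (step \o phi) V s.
Proof. by elim: s => //= a s IH v /IH; exact: sub_step. Qed.

Lemma hull_foldr_step (T : eqType) (phi : T -> 'I_n -> R -> R) s V c w a :
  contraction (phi a) -> 0 <= c -> balanced V -> a \in s -> hull c V w ->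
  hull c (foldr (step \o phi) V s) (fun i => phi a i (w i)).
Proof.
move=> phiC c0 Vb + Vw; elim: s => //= b s IH; rewrite inE => /predU1P[<-|/IH].
  apply: hull_step => //; first exact: balanced_foldr_step.
  exact: (hullS (@sub_foldr_step _ phi s V)).
by apply: hullS; exact: sub_step.
Qed.

Definition reluv : 'I_n -> R -> R := fun=> @relu R.
Definition absv : 'I_n -> R -> R := fun=> Num.norm.
Definition maskv (T : eqType) (act : 'I_n -> T) (a : T) : 'I_n -> R -> R :=
  fun i x => (act i == a)%:R * x.

Lemma relu_lip (x y : R) : `|relu x - relu y| <= `|x - y|.
Proof. rewrite /relu /Num.max; do 2 case: ltP => ?; rewrite ?ler_norml ?subrr ?normr0//;
  have := ler_norm (x - y); have := ler_norm (- (x - y)); rewrite normrN; lra. Qed.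

Lemma contraction_relu : contraction reluv.
Proof.
split=> [i x y|i c x c0]; first exact: relu_lip.
by rewrite /reluv /relu maxr_pMr// mulr0.
Qed.

Lemma contraction_abs : contraction absv.
Proof.
split=> [i x y|i c x c0]; first exact: ler_dist_dist.
by rewrite /absv normrM ger0_norm.
Qed.

Lemma contraction_mask (T : eqType) (act : 'I_n -> T) a : contraction (maskv act a).
Proof.
split=> [i x y|i c x c0]; last by rewrite /maskv mulrCA.
by rewrite /maskv -mulrBr normrM; case: eqP; rewrite ?normr1 ?normr0 ?mul1r ?mul0r.
Qed.

(* max x y = (x + y) / 2 + |x - y| / 2 lets the coefficients of the hull add up. *)
Lemma hull_bigmax (I : Type) (s : seq I) V c0 (c : I -> R) F0 (F : I -> 'I_n -> R) :
  balanced V -> 0 <= c0 -> (forall a, 0 <= c a) -> hull c0 V F0 ->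
  (forall a, hull (c a) V (F a)) ->
  hull (c0 + \sum_(a <- s) c a) (iter (size s) (step absv) V)
       (fun i => \big[Num.max/F0 i]_(a <- s) F a i).
Proof.
move=> Vb c00 cge0 VF0 VF; elim: s => [|a s IH].
  by rewrite big_nil addr0; under [X in hull _ _ X]eq_fun do rewrite big_nil.
rewrite big_cons; under [X in hull _ _ X]eq_fun do rewrite big_cons.
set V' := iter _ _ V in IH; set M := fun i => \big[_/_]_(_ <- s) _ in IH.
set cM := c0 + _ in IH.
have cM0 : 0 <= cM by rewrite addr_ge0// sumr_ge0.
have V'b : balanced V' by exact: balanced_iter_step.
have V'Fa : hull (c a) V' (F a) by apply: (hullS (@sub_iter_step absv V (size s))).
have -> : (fun i => Num.max (F a i) (\big[Num.max/F0 i]_(b <- s) F b i)) =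
  (fun i => 2^-1 * (F a i + M i) + 2^-1 * absv i (F a i + -1 * M i)).
  apply/funext => i; rewrite -/(M i) /absv mulN1r /Num.max.
  by case: ltrP => h /=; lra.
have -> : c0 + (c a + \sum_(j <- s) c j) =
   `|2^-1| * (c a + cM) + `|2^-1| * (c a + `|-1| * cM).
  by rewrite gtr0_norm// normrN1 /cM; field.
rewrite normrN1 mul1r -[iter _ _ _]/(step absv V').
have cac : 0 <= c a + cM by exact: addr_ge0.
apply: hullD; rewrite ?mulr_ge0//.
  apply: (hullS (@sub_step absv V')); apply: hullZ => //; exact: hullD.
apply: hullZ; first exact: balanced_step.
apply: hull_step => //; first exact: contraction_abs.
apply: hullD => //; rewrite -[cM]mul1r -[X in X * cM](@normrN1 R).
exact: hullZ.
Qed.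

(** Selecting the network of the action taken is a sum of masked networks. The masks are different
    maps, so each action costs one step. *)
Lemma hull_select (K : nat) (act : 'I_n -> 'I_K) V (c : 'I_K -> R) (F : 'I_K -> 'I_n -> R) :
  balanced V -> (forall a, 0 <= c a) -> (forall a, hull (c a) V (F a)) ->
  hull (\sum_a c a) (foldr (step \o maskv act) V (enum 'I_K)) (fun i => F (act i) i).
Proof.
move=> Vb c0 VF; have -> : (fun i => F (act i) i) = fun i => \sum_a maskv act a i (F a i).
  apply/funext => i; rewrite (bigD1 (act i))//= /maskv eqxx mul1r big1 ?addr0// => a.
  by rewrite eq_sym => /negPf ->; rewrite mul0r.
apply: hull_sum => //; first exact: balanced_foldr_step.
move=> a; apply: hull_foldr_step => //; [exact: contraction_mask|exact: mem_enum].
Qed.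

End Hull.

(** * Residual networks *)

Section ResNet.
Context {R : realType} {d m D L : nat}.
Implicit Types (th : resnet_param R d m D L) (h : 'cV[R]_D) (x y : 'rV[R]_d).

Definition layer th h (l : 'I_L) := h + rn_U th l *m relu_mx (rn_W th l *m h).

Definition path_layer th (p : 'cV[R]_D) (l : 'I_L) :=
  p + 3 *: (abs_mx (rn_U th l) *m (abs_mx (rn_W th l) *m p)).

(* [path_vec th i] is the weighted path norm of the [i]-th last hidden coordinate. *)
Definition path_vec th := foldl (path_layer th) (abs_mx (rn_V th) *m const_mx 1) (enum 'I_L).

Lemma layerE th h l i : layer th h l i 0 =
  h i 0 + \sum_k rn_U th l i k * relu (\sum_j rn_W th l k j * h j 0).
Proof. by rewrite !mxE; congr (_ + _); apply: eq_bigr => k _; rewrite !mxE. Qed.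

Lemma path_layerE th (p : 'cV[R]_D) l i : path_layer th p l i 0 =
  p i 0 + 3 * \sum_k `|rn_U th l i k| * \sum_j `|rn_W th l k j| * p j 0.
Proof.
rewrite !mxE; congr (_ + 3 * _); apply: eq_bigr => k _; rewrite !mxE; congr (_ * _).
by apply: eq_bigr => j _; rewrite !mxE.
Qed.

Lemma path_layer_ge0 th (p : 'cV[R]_D) l : (forall i, 0 <= p i 0) ->
  forall i, 0 <= path_layer th p l i 0.
Proof.
move=> p0 i; rewrite path_layerE addr_ge0// mulr_ge0// sumr_ge0// => k _.
by rewrite mulr_ge0// sumr_ge0// => j _; rewrite mulr_ge0.
Qed.

Lemma path_vec0_ge0 th i : 0 <= (abs_mx (rn_V th) *m const_mx 1 : 'cV_D) i 0.
Proof. by rewrite mxE sumr_ge0// => j _; rewrite !mxE mulr1. Qed.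

Lemma path_vec_ge0 th i : 0 <= path_vec th i 0.
Proof.
rewrite /path_vec; elim: (enum _) (abs_mx _ *m _) i (@path_vec0_ge0 th) => //= l s IH p i p0.
by apply: IH; exact: path_layer_ge0.
Qed.

(** All factors have nonnegative entries, so the l1 norm is a pairing with the all-ones vector, and
    by associativity the product acts on that vector layer by layer. *)
Lemma path_normE th : path_norm th = \sum_i `|rn_u th i 0| * path_vec th i 0.
Proof.
have PE : path_prod th *m (abs_mx (rn_V th) *m (const_mx 1 : 'cV_d)) = path_vec th.
  suff h (s : seq 'I_L) (P : 'M[R]_D) (A : 'cV[R]_D) : foldl (fun P (l : 'I_L) => (1%:M +
      3 *: (abs_mx (rn_U th l) *m abs_mx (rn_W th l))) *m P) P s *m A =
      foldl (path_layer th) (P *m A) s.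
    by rewrite /path_prod h mul1mx.
  elim: s P => //= l s IH P; rewrite IH; congr foldl.
  by rewrite /path_layer !mulmxDl !mul1mx -!scalemxAl -!mulmxA.
pose nonneg q r (A : 'M[R]_(q, r)) := forall i j, 0 <= A i j.
have nnM q r t (A : 'M[R]_(q, r)) (B : 'M[R]_(r, t)) :
    nonneg _ _ A -> nonneg _ _ B -> nonneg _ _ (A *m B).
  by move=> A0 B0 i j; rewrite mxE sumr_ge0// => k _; rewrite mulr_ge0.
have nn_abs q r (A : 'M[R]_(q, r)) : nonneg _ _ (abs_mx A) by move=> i j; rewrite mxE.
have P0 : nonneg _ _ (path_prod th).
  suff h (s : seq 'I_L) (P : 'M[R]_D) : nonneg D D P ->
      nonneg D D (foldl (fun P (l : 'I_L) => (1%:M +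
      3 *: (abs_mx (rn_U th l) *m abs_mx (rn_W th l))) *m P) P s).
    by apply: h => i j; rewrite mxE ler0n.
  elim: s P => //= l s IH P Pge0; apply: IH; apply: nnM => // i j.
  rewrite !mxE addr_ge0 ?ler0n// mulr_ge0// sumr_ge0// => k _.
  by rewrite !mxE mulr_ge0.
have u0 : nonneg _ _ (abs_mx (rn_u th))^T by move=> i j; rewrite !mxE.
have B0 : nonneg _ _ ((abs_mx (rn_u th))^T *m path_prod th *m abs_mx (rn_V th)).
  by apply: (nnM) => //; exact: nnM.
rewrite /path_norm (eq_bigr (fun j => ((abs_mx (rn_u th))^T *m path_prod th *m
  abs_mx (rn_V th)) 0 j * (const_mx 1 : 'cV_d) j 0)) => [|j _]; last first.
  by rewrite ger0_norm// [const_mx _ _ _]mxE mulr1.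
transitivity (((abs_mx (rn_u th))^T *m path_vec th) 0 0).
  by rewrite -PE !mulmxA mxE.
by rewrite mxE; apply: eq_bigr => i _; rewrite !mxE.
Qed.

(** One step per layer suffices whatever the width: every preactivation lies in a hull of the
    current set, and outer weights only rescale. The radii grow at most as in [path_layer]. The base
    set varies in the induction, since the remaining layers start from [step reluv V]. *)
Lemma hull_foldl_layer n th V (s : seq 'I_L) (h : 'I_n -> 'cV[R]_D) (p : 'cV[R]_D) :
  balanced V -> (forall i, 0 <= p i 0 /\ hull (p i 0) V (fun t => h t i 0)) ->
  forall i, hull (foldl (path_layer th) p s i 0) (iter (size s) (step reluv) V)
     (fun t => foldl (layer th) (h t) s i 0).
Proof.
elim: s V h p => [|l s IH] V h p Vb hp i /=; first by have [] := hp i.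
rewrite -iterS iterSr; apply: IH; first exact: balanced_step.
move=> {}i; split; first by apply: path_layer_ge0 => j; have [] := hp j.
rewrite path_layerE.
have -> : (fun t => layer th (h t) l i 0) = fun t => h t i 0 +
    \sum_k rn_U th l i k * reluv t (\sum_j rn_W th l k j * h t j 0).
  by apply/funext => t; rewrite layerE.
have [pi0 hi] := hp i.
pose q k := \sum_j `|rn_W th l k j| * p j 0.
have q0 k : 0 <= q k by apply: sumr_ge0 => j _; rewrite mulr_ge0//; have [] := hp j.
have s0 : 0 <= \sum_k `|rn_U th l i k| * q k by apply: sumr_ge0 => k _; rewrite mulr_ge0.
apply: (@hull_le _ _ (p i 0 + \sum_k `|rn_U th l i k| * q k)).
- exact: balanced_step.
- by rewrite addr_ge0//= lerD2l; move: s0; rewrite /q; lra.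
apply: hullD => //; first exact: (hullS (@sub_step _ _ reluv V)).
apply: hull_sum; first exact: balanced_step.
  by move=> k; rewrite mulr_ge0.
move=> k; apply: hullZ; first exact: balanced_step.
apply: hull_step => //; first exact: contraction_relu.
apply: hull_sum => // j; first by rewrite mulr_ge0//; have [] := hp j.
by apply: hullZ => //; have [] := hp j.
Qed.

Lemma hull_resnet n th V (x : 'I_n -> 'rV[R]_d) :
  balanced V -> (forall j, V (fun t => x t 0 j)) ->
  hull (path_norm th) (iter L (step reluv) V) (fun t => resnet th (x t)).
Proof.
move=> Vb Vx; rewrite path_normE.
have -> : (fun t => resnet th (x t)) = fun t => \sum_i rn_u th i 0 * resnet_hidden th (x t) i 0.
  by apply/funext => t; rewrite /resnet mxE; apply: eq_bigr => i _; rewrite mxE.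
apply: hull_sum; first exact: balanced_iter_step.
  by move=> i; rewrite mulr_ge0// path_vec_ge0.
move=> i; apply: hullZ; first exact: balanced_iter_step.
rewrite -[X in iter X _ _]card_ord cardE; apply: hull_foldl_layer => // {}i.
split; first exact: path_vec0_ge0.
rewrite mxE.
have -> : (fun t => (rn_V th *m (x t)^T) i 0) = fun t => \sum_j rn_V th i j * x t 0 j.
  by apply/funext => t; rewrite mxE; apply: eq_bigr => j _; rewrite mxE.
apply: hull_sum => // j; rewrite !mxE ?mulr1//.
by rewrite -[X in hull X]mulr1; apply: hullZ => //; exact: hull_incl.
Qed.

Lemma foldl_layer_lip th (s : seq 'I_L) h h' (p : 'cV[R]_D) (delta : R) :
  0 <= delta -> (forall i, 0 <= p i 0 /\ `|h i 0 - h' i 0| <= p i 0 * delta) ->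
  forall i, `|foldl (layer th) h s i 0 - foldl (layer th) h' s i 0| <=
     foldl (path_layer th) p s i 0 * delta.
Proof.
move=> delta0; elim: s h h' p => [|l s IH] h h' p hp i /=; first by have [] := hp i.
apply: IH => {}i; split; first by apply: path_layer_ge0 => j; have [] := hp j.
rewrite !layerE path_layerE opprD addrACA -sumrB mulrDl.
have [pi0 hi] := hp i; rewrite (le_trans (ler_normD _ _))// lerD//.
pose q k := \sum_j `|rn_W th l k j| * p j 0.
have q0 k : 0 <= q k by apply: sumr_ge0 => j _; rewrite mulr_ge0//; have [] := hp j.
have s0 : 0 <= \sum_k `|rn_U th l i k| * q k by apply: sumr_ge0 => k _; rewrite mulr_ge0.
apply: (@le_trans _ _ ((\sum_k `|rn_U th l i k| * q k) * delta)); last first.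
  by rewrite ler_wpM2r//; move: s0; rewrite /q; lra.
rewrite mulr_suml (le_trans (ler_norm_sum _ _ _))//; apply: ler_sum => k _.
rewrite -mulrBr normrM -mulrA ler_wpM2l// (le_trans (relu_lip _ _))//.
rewrite -sumrB mulr_suml (le_trans (ler_norm_sum _ _ _))//; apply: ler_sum => j _.
by rewrite -mulrBr normrM -mulrA ler_wpM2l//; have [] := hp j.
Qed.

(** A sup-norm perturbation of the input spreads through the layers by the recursion that defines
    the path norm, which is therefore a Lipschitz constant. *)
Lemma resnet_lip th x y (delta : R) : 0 <= delta ->
  (forall j, `|x 0 j - y 0 j| <= delta) ->
  `|resnet th x - resnet th y| <= path_norm th * delta.
Proof.
move=> delta0 xy; rewrite /resnet !mxE -sumrB path_normE mulr_suml.
rewrite (le_trans (ler_norm_sum _ _ _))//; apply: ler_sum => i _.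
rewrite -mulrBr normrM -mulrA !mxE ler_wpM2l//.
apply: foldl_layer_lip => // {}i; split; first exact: path_vec0_ge0.
rewrite !mxE -sumrB mulr_suml (le_trans (ler_norm_sum _ _ _))//; apply: ler_sum => j _.
by rewrite -mulrBr normrM !mxE mulr1 ler_wpM2l.
Qed.

Lemma resnet0 th : resnet th 0 = 0.
Proof.
rewrite /resnet /resnet_hidden trmx0 mulmx0.
have -> : foldl (layer th) 0 (enum 'I_L) = 0.
  elim: (enum _) => //= l s IH; rewrite /layer !mulmx0 add0r.
  rewrite (_ : relu_mx 0 = 0) ?mulmx0//.
  by apply/matrixP => i j; rewrite !mxE /relu maxxx.
by rewrite mulmx0 mxE.
Qed.

Lemma path_norm_ge0 th : 0 <= path_norm th.
Proof. by rewrite /path_norm sumr_ge0. Qed.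

Lemma resnet_le th x : (forall j, `|x 0 j| <= 1) -> `|resnet th x| <= path_norm th.
Proof.
move=> x1; have := @resnet_lip th x 0 1 ler01; rewrite resnet0 subr0 mulr1; apply=> j.
by rewrite mxE subr0.
Qed.

End ResNet.

(** * Symmetrization *)

Lemma jensen_expR (R : realType) (I : finType) (w x : I -> R) :
  (forall i, 0 <= w i) -> \sum_i w i = 1 ->
  expR (\sum_i w i * x i) <= \sum_i w i * expR (x i).
Proof.
move=> w0 w1; set m := \sum_i w i * x i.
have -> : expR m = \sum_i w i * (expR m * (1 + (x i - m))).
  under eq_bigr do rewrite mulrCA.
  rewrite -mulr_sumr; under eq_bigr do rewrite mulrDr mulr1 mulrBr.
  by rewrite big_split /= sumrB -mulr_suml w1 mul1r subrr addr0 mulr1.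
apply: ler_sum => i _; rewrite ler_wpM2l//.
have -> : expR (x i) = expR m * expR (x i - m) by rewrite -expRD addrC subrK.
by rewrite ler_wpM2l ?expR_ge0// expR_ge1Dx.
Qed.

(** Separates the sample from the ghost sample after symmetrization. The exponent doubles, hence
    [rad_bound (2 * t)] below. *)
Lemma expRD_le (R : realType) (a b : R) :
  2 * expR (a + b) <= expR (2 * a) + expR (2 * b).
Proof.
rewrite expRD ![2 * _]mulrC !mulr2n !mulrDr !mulr1 !expRD.
by have := sqr_ge0 (expR a - expR b); rewrite sqrrB; lra.
Qed.

Section Symmetrization.
Context {R : realType} {C : finType} {T : Type} {n : nat}.
Variables (p : C -> R) (phi : T -> C -> R).
Hypotheses (p0 : forall x, 0 <= p x) (p1 : \sum_x p x = 1).
Implicit Types (c : {ffun 'I_n -> C}) (e : {ffun 'I_n -> bool}).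

Definition prod_weight c := \prod_i p (c i).
Definition pmean theta := \sum_x p x * phi theta x.
Definition deviation theta c := \sum_i (pmean theta - phi theta (c i)).

Lemma prod_weight_ge0 c : 0 <= prod_weight c.
Proof. exact: prodr_ge0. Qed.

Lemma sum_prod_weight : \sum_c prod_weight c = 1.
Proof.
by rewrite -(bigA_distr_bigA (fun i : 'I_n => p)) big1// => i _; exact: p1.
Qed.

Lemma sum_prod_weight_coord (f : C -> R) i :
  \sum_c prod_weight c * f (c i) = \sum_x p x * f x.
Proof.
have -> : \sum_c prod_weight c * f (c i) =
    \sum_(c : {ffun 'I_n -> C}) \prod_j (p (c j) * (if j == i then f (c j) else 1)).
  apply: eq_bigr => c _; rewrite big_split /=; congr (_ * _).
  by rewrite (bigD1 i)//= eqxx big1 ?mulr1// => j /negPf ->.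
rewrite -(bigA_distr_bigA (fun j x => p x * (if j == i then f x else 1))).
rewrite (bigD1 i)//= eqxx [X in _ * X]big1 ?mulr1// => j /negPf ->.
by rewrite -[RHS]p1; apply: eq_bigr => x _; rewrite mulr1.
Qed.

Definition swap e (cc : {ffun 'I_n -> C} * {ffun 'I_n -> C}) :
    {ffun 'I_n -> C} * {ffun 'I_n -> C} :=
  ([ffun i => if e i then cc.2 i else cc.1 i], [ffun i => if e i then cc.1 i else cc.2 i]).

Lemma swapK e : involutive (swap e).
Proof.
by case=> c c'; congr (_, _); apply/ffunP => i; rewrite !ffunE /= ?ffunE; case: (e i).
Qed.

(** [theta] depends on the sample. Once coordinates are swapped with a ghost sample it depends on
    the swap pattern, that is, on the signs, as [rad_bound] permits. *)
Lemma symmetrization (t B : R) (theta : {ffun 'I_n -> C} -> T) :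
  (forall c, rad_bound (2 * t) (range (fun th i => phi th (c i))) B) ->
  \sum_c prod_weight c * expR (t * deviation (theta c) c) <= B.
Proof.
move=> radB.
pose w (cc : {ffun 'I_n -> C} * {ffun 'I_n -> C}) := prod_weight cc.1 * prod_weight cc.2.
pose X (cc : {ffun 'I_n -> C} * {ffun 'I_n -> C}) :=
  expR (t * \sum_i (phi (theta cc.1) (cc.2 i) - phi (theta cc.1) (cc.1 i))).
have w0 cc : 0 <= w cc by rewrite mulr_ge0 ?prod_weight_ge0.
have sw1 : \sum_cc w cc = 1.
  rewrite -(pair_bigA _ (fun c c' => prod_weight c * prod_weight c')) /=.
  by under eq_bigr do rewrite -mulr_sumr sum_prod_weight mulr1; exact: sum_prod_weight.
apply: (@le_trans _ _ (\sum_cc w cc * X cc)).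
  (* Jensen's inequality in the ghost sample [c'], over which [phi] averages to [pmean]. *)
  rewrite -(pair_bigA _ (fun c c' => w (c, c') * X (c, c'))) /=; apply: ler_sum => c _.
  under eq_bigr do rewrite /w /= -mulrA.
  rewrite -mulr_sumr ler_wpM2l ?prod_weight_ge0//.
  apply: le_trans (jensen_expR _ prod_weight_ge0 sum_prod_weight).
  rewrite ler_expR le_eqVlt; apply/orP; left; apply/eqP.
  rewrite /= -[RHS](_ : t * (\sum_c' prod_weight c' *
      \sum_i (phi (theta c) (c' i) - phi (theta c) (c i))) = _); last first.
    by rewrite mulr_sumr; apply: eq_bigr => c' _; rewrite mulrCA.
  congr (t * _); under [RHS]eq_bigr do rewrite mulr_sumr.
  rewrite exchange_big; apply: eq_bigr => i _.
  under [RHS]eq_bigr do rewrite mulrBr.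
  by rewrite sumrB sum_prod_weight_coord -mulr_suml sum_prod_weight mul1r.
(* Swaps preserve the weights, so the double average may be averaged once more over all swap
   patterns. *)
have wswap e cc : w (swap e cc) = w cc.
  rewrite /w /prod_weight -!big_split; apply: eq_bigr => i _ /=; rewrite !ffunE.
  by case: (e i) => //; rewrite mulrC.
have card_signs : (\sum_(e : {ffun 'I_n -> bool}) 1) = 2 ^+ n :> R.
  by rewrite sumr_const card_ffun card_bool card_ord -natrX.
rewrite -(@ler_pM2l _ (2 ^+ n)) ?exprn_gt0//.
have -> : 2 ^+ n * \sum_cc w cc * X cc = \sum_cc w cc * \sum_e X (swap e cc).
  rewrite -card_signs mulr_suml.
  under [RHS]eq_bigr do rewrite mulr_sumr.
  rewrite [RHS]exchange_big; apply: eq_bigr => e _; rewrite mul1r.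
  rewrite (reindex_inj (inv_inj (swapK e))) /=.
  by apply: eq_bigr => cc _; rewrite wswap.
rewrite -[leRHS]mul1r -[X in _ <= X * _]sw1 [leRHS]mulr_suml.
apply: ler_sum => cc _; rewrite ler_wpM2l//.
pose v (c : {ffun 'I_n -> C}) e i := phi (theta (swap e cc).1) (c i).
have vin c e : range (fun th i => phi th (c i)) (v c e) by exists (theta (swap e cc).1).
have h1 := radB cc.2 (v cc.2) (vin cc.2).
have h2 := rad_bound_opp (radB cc.1) (v := fun e i => - v cc.1 e i)
  (fun e => ex_intro2 _ _ _ (vin cc.1 e) erefl).
rewrite -(@ler_pM2l _ 2)// mulr_sumr [leRHS](_ : _ = 2 ^+ n * B + 2 ^+ n * B);
  last by rewrite mulr_natl mulr2n.
rewrite (le_trans _ (lerD h1 h2))// -big_split; apply: ler_sum => e _ /=.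
apply: (le_trans _ (le_trans (expRD_le (t * sgnsum e (v cc.2 e))
  (t * sgnsum e (fun i => - v cc.1 e i))) _)); last by rewrite !mulrA.
rewrite ler_pM2l// -mulrDr -sgnsumD ler_expR le_eqVlt; apply/orP; left; apply/eqP.
congr (t * _); apply: eq_bigr => i _; rewrite /v /= !ffunE.
by case: (e i); rewrite ?expr1 ?expr0 ?mul1r// mulN1r opprB addrC.
Qed.

(** Markov's inequality for a choice that picks a violating parameter at every sample that has
    one. *)
Lemma deviation_tail (theta0 : T) (t B eta : R) : 0 <= t ->
  (forall c, rad_bound (2 * t) (range (fun th i => phi th (c i))) B) ->
  \sum_(c | `[< exists theta, eta < deviation theta c >]) prod_weight c <=
  B * expR (- (t * eta)).
Proof.
move=> t0 radB.
pose theta c := if pselect (exists theta, eta < deviation theta c) is left h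
  then sval (cid h) else theta0.
have := symmetrization theta radB; rewrite -(ler_pM2r (expR_gt0 (- (t * eta)))).
apply: le_trans; rewrite mulr_suml big_mkcond; apply: ler_sum => c _.
case: asboolP => h; last by rewrite !mulr_ge0 ?expR_ge0 ?prod_weight_ge0.
rewrite -mulrA -expRD ler_peMr ?prod_weight_ge0// -expR0 ler_expR.
rewrite -mulrBr mulr_ge0// subr_ge0 ltW// /theta.
by case: pselect => // h'; case: cid.
Qed.

End Symmetrization.

(** * The class of Bellman residuals *)

Lemma rad_boundS (R : realType) n (tau : R) (V W : set ('I_n -> R)) B :
  V `<=` W -> rad_bound tau W B -> rad_bound tau V B.
Proof. by move=> VW WB v Vv; apply: WB => e; exact: VW. Qed.

Lemma rad_bound_range (R : realType) n (J : finType) (b : J -> 'I_n -> R) tau :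
  (forall j i, `|b j i| <= 1) ->
  rad_bound tau (range b) (#|J|%:R * expR (2 * tau ^+ 2 * n%:R)).
Proof.
move=> b1 v Vv; rewrite mulrCA.
apply: (@le_trans _ _ (\sum_(j : J) \sum_e expR (tau * sgnsum e (b j)))).
  rewrite exchange_big; apply: ler_sum => e _; have [j _ <-] := Vv e.
  by rewrite (bigD1 j)//= lerDl sumr_ge0// => k _; exact: expR_ge0.
rewrite [leRHS](_ : _ = \sum_(j : J) (2 ^+ n * expR (2 * tau ^+ 2 * n%:R))); last first.
  by rewrite sumr_const [LHS]mulr_natl.
apply: ler_sum => j _.
by have := rad_bound_set1 tau (b1 j); move=> /(_ (fun=> b j)); apply.
Qed.

Lemma max_act_le (R : realType) alpha (F : 'I_(2 ^ alpha) -> R) c :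
  (forall a, F a <= c) -> max_act F <= c.
Proof. by move=> Fc; rewrite /max_act; elim/big_ind: _ => // x y xc yc; rewrite ge_max xc. Qed.

Lemma max_act_ge (R : realType) alpha (F : 'I_(2 ^ alpha) -> R) a : F a <= max_act F.
Proof. by rewrite /max_act (bigD1 a)//= le_max lexx. Qed.

Lemma max_act_dist (R : realType) alpha (F G : 'I_(2 ^ alpha) -> R) c :
  (forall a, `|F a - G a| <= c) -> `|max_act F - max_act G| <= c.
Proof.
move=> FG; rewrite ler_distl; apply/andP; split.
  rewrite lerBlDr; apply: max_act_le => a.
  have := FG a; have := max_act_ge F a; rewrite ler_distl; lra.
apply: max_act_le => a; have := FG a; have := max_act_ge G a; rewrite ler_distl; lra.
Qed.

Section BellmanClass.
Context {R : realType} {alpha d m D L : nat}.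
Variables (r : 'rV[R]_d -> 'I_(2 ^ alpha) -> R).
Variables (g : 'rV[R]_d -> 'I_(2 ^ alpha) -> R -> 'rV[R]_d) (gamma dt : R).
Implicit Types (Th : 'I_(2 ^ alpha) -> resnet_param R d m D L).
Hypothesis gamma01 : 0 <= gamma <= 1.

(* 3 and not 2 because the initial value of the iterated maximum in [max_act]
   duplicates an action, so [hull_bigmax] only gives the coefficient 2 Lambda. *)
Definition bellman_scale Th : R := 3 * family_path_norm Th + 1.

Definition scaled_loss Th s a : R :=
  (bellman_res r g gamma dt Th s a / bellman_scale Th) ^+ 2 / 2.

Lemma family_path_norm_ge0 Th : 0 <= family_path_norm Th.
Proof. by apply: sumr_ge0 => a _; exact: path_norm_ge0. Qed.

Lemma path_norm_le_family Th a : path_norm (Th a) <= family_path_norm Th.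
Proof.
rewrite /family_path_norm (bigD1 a)//= lerDl; apply: sumr_ge0 => b _.
exact: path_norm_ge0.
Qed.

Lemma bellman_scale_gt0 Th : 0 < bellman_scale Th.
Proof. by rewrite ltr_wpDl// mulr_ge0// family_path_norm_ge0. Qed.

Definition admissible_point (s : 'rV[R]_d) a :=
  [/\ forall j, `|s 0 j| <= 1, forall j, `|g s a dt 0 j| <= 1 & `|r s a| <= 1].

Lemma bellman_res_le Th s a : admissible_point s a ->
  `|bellman_res r g gamma dt Th s a| <= bellman_scale Th.
Proof.
move=> [s1 g1 r1]; have L0 := family_path_norm_ge0 Th.
have /andP[g0 g1'] := gamma01.
have h1 : `|resnet (Th a) s| <= family_path_norm Th.
  by rewrite (le_trans (resnet_le _ s1))// path_norm_le_family.
have h2 : `|max_act (fun a' => resnet (Th a') (g s a dt))| <= family_path_norm Th.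
  rewrite -[X in `|X|]subr0; have -> : 0 = max_act (fun _ : 'I_(2 ^ alpha) => 0 : R).
    by rewrite /max_act; elim/big_ind: _ => // x y <- <-; rewrite maxxx.
  apply: max_act_dist => a'; rewrite subr0.
  by rewrite (le_trans (resnet_le _ g1))// path_norm_le_family.
have h3 : `|gamma * max_act (fun a' => resnet (Th a') (g s a dt))| <= family_path_norm Th.
  rewrite normrM (ger0_norm g0) (le_trans (ler_wpM2l g0 h2))//.
  by rewrite ler_piMl.
rewrite /bellman_res (le_trans (ler_normB _ _))//.
by have := ler_normB (resnet (Th a) s) (r s a); rewrite /bellman_scale; lra.
Qed.

(** The three closures are nested so that all summands of the residual lie in hulls of one set,
    where coefficients add: Lambda for the network, 1 for the reward, 2 Lambda for the maximum. *)
Lemma hull_bellman n (s : 'I_n -> 'rV[R]_d) (a : 'I_n -> 'I_(2 ^ alpha)) V Th :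
  balanced V -> (forall j, V (fun i => s i 0 j)) ->
  (forall j, V (fun i => g (s i) (a i) dt 0 j)) -> V (fun i => r (s i) (a i)) ->
  hull (bellman_scale Th)
    (foldr (step \o maskv a) (iter (2 ^ alpha) (step absv) (iter L (step reluv) V))
       (enum 'I_(2 ^ alpha)))
    (fun i => bellman_res r g gamma dt Th (s i) (a i)).
Proof.
move=> Vb Vs Vg Vr; have /andP[g0 g1] := gamma01; have L0 := family_path_norm_ge0 Th.
set V1 := iter L _ V; set V2 := iter _ _ V1; set V3 := foldr _ _ _.
have V1b : balanced V1 by exact: balanced_iter_step.
have V2b : balanced V2 by exact: balanced_iter_step.
have V3b : balanced V3 by exact: balanced_foldr_step.
have V12 : V1 `<=` V2 by exact: sub_iter_step.
have V23 : V2 `<=` V3 by exact: sub_foldr_step.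
have p0 a' : 0 <= path_norm (Th a') := path_norm_ge0 (Th a').
have hf : hull (family_path_norm Th) V3 (fun i => resnet (Th (a i)) (s i)).
  apply: (hull_select a (F := fun a' i => resnet (Th a') (s i))) => // a'.
  by apply: (hullS V12); exact: hull_resnet.
have hr : hull 1 V3 (fun i => -1 * r (s i) (a i)).
  have := @hullZ _ _ (-1) 1 V3 (fun i => r (s i) (a i)) V3b; rewrite normrN1 mulr1; apply.
  apply: (hullS V23); apply: (hullS V12); apply: hull_incl.
  exact: sub_iter_step.
have hm : hull (2 * family_path_norm Th) V3
    (fun i => - gamma * max_act (fun a' => resnet (Th a') (g (s i) (a i) dt))).
  have c0 : 0 <= path_norm (Th (act0 alpha)) + family_path_norm Th by exact: addr_ge0.
  have c1 : gamma * (path_norm (Th (act0 alpha)) + family_path_norm Th) <=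
      2 * family_path_norm Th.
    rewrite (le_trans (ler_wpM2r c0 g1))// mul1r.
    by have := path_norm_le_family Th (act0 alpha); lra.
  apply: (@hull_le _ _ (`|- gamma| * (path_norm (Th (act0 alpha)) + family_path_norm Th))) => //.
    by rewrite normrN ger0_norm// c1 mulr_ge0.
  apply: hullZ => //; apply: (hullS V23).
  have -> : V2 = iter (size (index_enum 'I_(2 ^ alpha))) (step absv) V1.
    by rewrite [index_enum _]unlock -enumT -cardE card_ord.
  apply: (@hull_bigmax _ _ _ _ V1 _ (fun a' => path_norm (Th a'))
    (fun i => resnet (Th (act0 alpha)) (g (s i) (a i) dt))
    (fun a' i => resnet (Th a') (g (s i) (a i) dt))) => //.
    exact: hull_resnet.
  by move=> a'; exact: hull_resnet.
have -> : bellman_scale Th = family_path_norm Th + 1 + 2 * family_path_norm Th.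
  by rewrite /bellman_scale; ring.
rewrite (_ : (fun i => _) = fun i => resnet (Th (a i)) (s i) + -1 * r (s i) (a i) +
  - gamma * max_act (fun a' => resnet (Th a') (g (s i) (a i) dt))); last first.
  by apply/funext => i; rewrite /bellman_res mulN1r mulNr.
apply: hullD => //; rewrite ?addr_ge0 ?mulr_ge0//; exact: hullD.
Qed.

Lemma rad_bound_loss n (s : 'I_n -> 'rV[R]_d) (a : 'I_n -> 'I_(2 ^ alpha)) tau :
  (0 < d)%N -> 0 <= tau -> (forall i, admissible_point (s i) (a i)) ->
  rad_bound tau (range (fun Th i => scaled_loss Th (s i) (a i)))
    (3 ^+ (L + 2 * 2 ^ alpha) * (8 * d%:R) * expR (2 * tau ^+ 2 * n%:R)).
Proof.
move=> d0 tau0 adm.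
(* The base vectors are zero, the rewards and the coordinates of both states, with either sign:
   [2 * (2 * d + 2)] of them, at most [8 * d] since [d] is positive. *)
pose b0 (j : option (option ('I_d + 'I_d))) i : R := match j with
  | None => 0 | Some None => r (s i) (a i)
  | Some (Some (inl k)) => s i 0 k | Some (Some (inr k)) => g (s i) (a i) dt 0 k end.
pose b (j : bool * option (option ('I_d + 'I_d))) i : R := (-1) ^+ j.1 * b0 j.2 i.
have b1 j i : `|b j i| <= 1.
  rewrite /b normrM normrX normrN1 expr1n mul1r.
  have [s1 g1 r1] := adm i.
  by case: j.2 => [[[k|k]|]|] //=; rewrite normr0.
pose V := range b.
have b0V j : V (b0 j) by exists (false, j) => //; apply/funext => i; rewrite /b mul1r.
have Vb : balanced V.
  split; first exact: (b0V None).
  move=> v [[e j] _ <-]; exists (~~ e, j) => //.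
  by apply/funext => i; rewrite /b /= signrN mulNr.
pose V3 := foldr (step \o maskv a)
  (iter (2 ^ alpha) (step absv) (iter L (step reluv) V)) (enum 'I_(2 ^ alpha)).
have radV3 : rad_bound tau V3 (3 ^+ (L + 2 * 2 ^ alpha) * (8 * d%:R) *
    expR (2 * tau ^+ 2 * n%:R)).
  have h1 : rad_bound tau (iter L (step reluv) V) _ :=
    rad_bound_iter tau0 contraction_relu Vb (rad_bound_range tau b1).
  have h2 : rad_bound tau (iter (2 ^ alpha) (step absv) (iter L (step reluv) V)) _ :=
    rad_bound_iter tau0 contraction_abs (balanced_iter_step _ _ Vb) h1.
  have h3 : rad_bound tau V3 _ := rad_bound_foldr tau0 (contraction_mask a)
    (balanced_iter_step _ _ (balanced_iter_step _ _ Vb)) h2.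
  move: h3.
  move=> h v Vv; apply: (le_trans (h v Vv)); rewrite ler_pM2l ?exprn_gt0//.
  rewrite -cardE card_ord !mulrA ler_wpM2r ?expR_ge0//.
  rewrite -!exprD (_ : (_ + _ + L = L + 2 * 2 ^ alpha)%N); last by lia.
  rewrite -mulrA ler_pM2l ?exprn_gt0// card_prod card_bool !card_option card_sum card_ord.
  by rewrite -natrM ler_nat; lia.
have vin Th : hull 1 V3 (fun i => bellman_res r g gamma dt Th (s i) (a i) / bellman_scale Th).
  have -> : 1 = `|(bellman_scale Th)^-1| * bellman_scale Th.
    rewrite gtr0_norm ?invr_gt0 ?bellman_scale_gt0// mulVf ?gt_eqF ?bellman_scale_gt0//.
  rewrite (_ : (fun i => _) = fun i => (bellman_scale Th)^-1 *
    bellman_res r g gamma dt Th (s i) (a i)); last by apply/funext => i; rewrite mulrC.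
  apply: hullZ; first exact/balanced_foldr_step/balanced_iter_step/balanced_iter_step.
  apply: hull_bellman => //.
  - by move=> j; exact: (b0V (Some (Some (inl j)))).
  - by move=> j; exact: (b0V (Some (Some (inr j)))).
  - exact: (b0V (Some None)).
pose res Th i := bellman_res r g gamma dt Th (s i) (a i) / bellman_scale Th.
have res1 Th i : `|res Th i| <= 1.
  rewrite normrM normfV (gtr0_norm (bellman_scale_gt0 Th)) ler_pdivrMr ?bellman_scale_gt0//.
  by rewrite mul1r bellman_res_le.
have radres : rad_bound tau (range res) (3 ^+ (L + 2 * 2 ^ alpha) * (8 * d%:R) *
    expR (2 * tau ^+ 2 * n%:R)).
  by apply: rad_boundS (rad_bound_hull tau0 radV3) => v [Th _ <-]; exact: vin.
(* Halved squaring is 1-Lipschitz on [[-1, 1]], where the scaled residuals take their values. *)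
pose G (v : 'I_n -> R) i := v i ^+ 2 / 2.
apply: (@rad_boundS _ _ _ _ (G @` range res)).
  by move=> v [Th _ <-]; exists (res Th).
apply: rad_bound_contraction radres => //.
  move=> v i [Th _ <-]; rewrite /G; have := res1 Th i; move: (res Th i) => x.
  rewrite ler_norml => x1; rewrite ger0_norm ?divr_ge0 ?sqr_ge0//.
  rewrite -real_normK ?num_real//; have : `|x| <= 1 by rewrite ler_norml.
  by have := normr_ge0 x; nra.
move=> v w i [Th _ <-] [Th' _ <-]; rewrite /G.
have := res1 Th i; have := res1 Th' i; move: (res Th i) (res Th' i) => x y y1 x1.
rewrite -mulrBl subr_sqr -mulrA normrM ler_piMr//.
by rewrite !ler_norml in x1 y1 *; lra.
Qed.

End BellmanClass.

(** * Integration on the state space *)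

Section IteratedLebesgue.
Context {R : realType} {d : nat}.
Implicit Types (y : nat -> R) (B : set 'rV[R]_d).

Definition tuple_of_env y : d.-tuple R := [tuple y i | i < d].

Definition update_env y k (t : R) : nat -> R := fun j => if j == k then t else y j.

(** A partial integral depends on the environment only through a [d]-tuple, and as a function of
    that tuple Tonelli makes it measurable, ready for the next integration. *)
Lemma iter_leb_measurable (H : d.-tuple R -> \bar R) k :
  measurable_fun [set: d.-tuple R] H -> (forall t, 0 <= H t)%E ->
  exists H' : d.-tuple R -> \bar R,
    [/\ measurable_fun [set: d.-tuple R] H', (forall t, 0 <= H' t)%E &
    forall y, iter_leb k (H \o tuple_of_env) y = H' (tuple_of_env y)].
Proof.
move=> mH H0; elim: k => [|k [H' [mH' H'0 HE]]]; first by exists H.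
pose upd (ts : d.-tuple R * R) : d.-tuple R :=
  [tuple if i == k :> nat then ts.2 else tnth ts.1 i | i < d].
have mupd : measurable_fun setT upd.
  apply/measurable_fun_tnthP => i.
  rewrite (_ : _ \o upd = fun ts => if i == k :> nat then ts.2 else tnth ts.1 i); last first.
    by apply/funext => ts /=; rewrite tnth_mktuple.
  case: (i == k :> nat); first exact: measurable_snd.
  apply: (measurableT_comp (measurable_tnth i)); exact: measurable_fst.
exists (fubini_F (@lebesgue_measure R) (H' \o upd)); split.
- apply: measurable_fun_fubini_tonelli_F => //=.
  exact: measurableT_comp.
- by move=> t; apply: integral_ge0 => s _; exact: H'0.
- move=> y /=; rewrite /fubini_F /=; apply: eq_integral => t _.
  rewrite HE; congr H'; apply: eq_from_tnth => i; rewrite !tnth_mktuple /=.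
  by case: eqP.
Qed.

Lemma iter_leb_sum (I : finType) (c : I -> R) (H : I -> d.-tuple R -> \bar R) k y :
  (forall i, 0 <= c i) ->
  (forall i, measurable_fun [set: d.-tuple R] (H i)) -> (forall i t, 0 <= H i t)%E ->
  iter_leb k (fun y => \sum_i (c i)%:E * H i (tuple_of_env y))%E y =
  (\sum_i (c i)%:E * iter_leb k (H i \o tuple_of_env) y)%E.
Proof.
move=> c0 mH H0; elim: k y => [//|k IH] y /=.
have mI i : measurable_fun setT (fun t : R =>
    iter_leb k (H i \o tuple_of_env) (update_env y k t)).
  have [H' [mH' _ HE]] := iter_leb_measurable k (mH i) (H0 i).
  rewrite (_ : (fun t => _) = fun t => H' (tuple_of_env (update_env y k t))).
    apply: (measurableT_comp mH'); apply/measurable_fun_tnthP => j.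
    rewrite (_ : _ \o _ = fun t => if j == k :> nat then t else y j); last first.
      by apply/funext => t; rewrite /= tnth_mktuple.
    by case: (j == k :> nat).
  by apply/funext => t; rewrite HE.
have I0 i t : (0 <= iter_leb k (H i \o tuple_of_env) (update_env y k t))%E.
  by have [H' [_ H'0 HE]] := iter_leb_measurable k (mH i) (H0 i); rewrite HE.
transitivity (\int[@lebesgue_measure R]_t
    \sum_i (c i)%:E * iter_leb k (H i \o tuple_of_env) (update_env y k t))%E.
  by apply: eq_integral => t _; rewrite -IH.
rewrite ge0_integral_sum//.
- apply: eq_bigr => i _; by apply: ge0_integralZl_EFin => //; exact: mI.
- by move=> i; apply: measurable_funeM; exact: mI.
- by move=> i t _; rewrite mule_ge0// lee_fin.
Qed.

(** The integral is a supremum over simple functions below the integrand, so measurability is not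
    involved. Losses can thus be bounded by functions constant on cells without being measurable
    themselves. *)
Lemma ge0_le_integral_nomeas (dT : measure_display) (T : measurableType dT)
    (mu : {measure set T -> \bar R}) (f1 f2 : T -> \bar R) :
  (forall x, 0 <= f1 x)%E -> (forall x, f1 x <= f2 x)%E ->
  (\int[mu]_x f1 x <= \int[mu]_x f2 x)%E.
Proof.
move=> f10 f12; rewrite !ge0_integralTE// => [|x]; last exact: le_trans (f12 x).
apply: ereal_sup_le => _ [h hf <-]; exists h => // x.
exact: le_trans (hf x) (f12 x).
Qed.

Lemma iter_leb_le (F G : (nat -> R) -> \bar R) k y :
  (forall y, 0 <= F y)%E -> (forall y, F y <= G y)%E ->
  (0 <= iter_leb k F y)%E /\ (iter_leb k F y <= iter_leb k G y)%E.
Proof.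
move=> F0 FG; elim: k y => [//|k IH] y /=; split.
  by apply: integral_ge0 => t _; case: (IH (update_env y k t)).
apply: ge0_le_integral_nomeas => t; by case: (IH (update_env y k t)).
Qed.

Lemma leb_vol_ge0 B : (0 <= leb_vol B)%E.
Proof.
have := @iter_leb_le (fun y => (\1_B (\row_(i < d) y i : 'rV[R]_d))%:E) _ d (fun=> 0)
  (fun y => _) (fun y => lexx _).
by case=> // y; rewrite lee_fin.
Qed.

Lemma leb_int_le_simple (I : finType) (c : I -> R) (B : I -> set 'rV[R]_d) (F : 'rV[R]_d -> R) :
  (forall i, 0 <= c i) -> (forall i, rV_measurable (B i)) ->
  (forall x, 0 <= F x) -> (forall x, F x <= \sum_i c i * \1_(B i) x) ->
  (leb_int (fun x => (F x)%:E) <= \sum_i (c i)%:E * leb_vol (B i))%E.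
Proof.
move=> c0 mB F0 FB; have /choice[B' hB'] := mB.
pose H i (t : d.-tuple R) : \bar R := (\1_(B' i) t)%:E.
have HE i : (fun y => (\1_(B i) (\row_(i < d) y i : 'rV[R]_d))%:E) = H i \o tuple_of_env.
  apply/funext => y; rewrite /= /H (hB' i).2 /=; congr EFin.
  rewrite !indicE; congr (_%:R); congr nat_of_bool; apply/asbool_equiv_eq.
  rewrite /preimage /=; have -> : rv2t (\row_(i0 < d) y i0) = tuple_of_env y => //.
  by apply: eq_from_tnth => j; rewrite !tnth_mktuple mxE.
have mH i : measurable_fun [set: d.-tuple R] (H i).
  by apply/measurable_EFinP; apply: measurable_indic; exact: (hB' i).1.
have H0 i t : (0 <= H i t)%E by rewrite lee_fin.
have -> : (\sum_i (c i)%:E * leb_vol (B i) =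
    \sum_i (c i)%:E * iter_leb d (H i \o tuple_of_env) (fun=> 0%R))%E.
  by apply: eq_bigr => i _; rewrite -HE.
rewrite -iter_leb_sum//; apply: (proj2 (@iter_leb_le _ _ d (fun=> 0) _ _)) => y; rewrite ?lee_fin//.
apply: (@le_trans _ _ (\sum_i c i * \1_(B i) (\row_(i < d) y i : 'rV[R]_d))%:E).
  by rewrite lee_fin.
rewrite -sumEFin le_eqVlt; apply/orP; left; apply/eqP; apply: eq_bigr => i _.
by rewrite EFinM; congr (_ * _)%E; exact: (congr1 (fun f => f y) (HE i)).
Qed.

Lemma unif_expect_le (S : set 'rV[R]_d) (I : finType) (c : I -> R) (B : I -> set 'rV[R]_d)
    (phi : 'rV[R]_d -> R) :
  (forall i, 0 <= c i) -> (forall i, rV_measurable (B i `&` S)) -> (forall x, 0 <= phi x) ->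
  (forall x, S x -> exists2 i, B i x & phi x <= c i) ->
  (unif_expect S phi <= \sum_i (c i)%:E * unif_prob S (B i))%E.
Proof.
move=> c0 mB phi0 hB.
have -> : (\sum_i (c i)%:E * unif_prob S (B i) = ((fine (leb_vol S))^-1)%:E *
    \sum_i (c i)%:E * leb_vol (B i `&` S))%E.
  rewrite ge0_sume_distrr// => [|i]; last by rewrite mule_ge0 ?lee_fin// leb_vol_ge0.
  by apply: eq_bigr => i _; rewrite /unif_prob muleCA.
rewrite /unif_expect lee_wpmul2l// ?lee_fin ?invr_ge0 ?fine_ge0 ?leb_vol_ge0//.
apply: leb_int_le_simple => // x; first by rewrite mulr_ge0.
have ge0 i : 0 <= c i * \1_(B i `&` S) x by rewrite mulr_ge0.
rewrite indicE; have [/set_mem Sx|/negP xS] := boolP (x \in S); last first.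
  by rewrite mul0r sumr_ge0.
rewrite mul1r; have [i Bix phic] := hB x Sx.
rewrite (bigD1 i)//= indicE mem_set//= mulr1 ler_wpDr//.
by rewrite sumr_ge0.
Qed.

End IteratedLebesgue.

(** * Monte Carlo approximation in Barron space *)

Lemma sqr_sum_le (R : realDomainType) (I : finType) (a : I -> R) :
  (\sum_i a i) ^+ 2 <= #|I|%:R * \sum_i a i ^+ 2.
Proof.
rewrite -(@ler_pM2l _ 2)// expr2 big_distrlr /=.
have -> : 2 * (#|I|%:R * \sum_i a i ^+ 2) = \sum_i \sum_j (a i ^+ 2 + a j ^+ 2).
  under [RHS]eq_bigr do rewrite big_split /= sumr_const -mulr_natl.
  by rewrite big_split /= -mulr_sumr sumr_const -[in RHS]mulr_natl; ring.
rewrite mulr_sumr; apply: ler_sum => i _; rewrite mulr_sumr; apply: ler_sum => j _.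
by have := sqr_ge0 (a i - a j); rewrite sqrrB; lra.
Qed.

Section HasMean.
Context {dT : measure_display} {T : measurableType dT} {R : realType} (P : probability T R).
Implicit Types (f : T -> R) (v : R).

Definition has_mean f v := P.-integrable setT (EFin \o f) /\ (\int[P]_x (f x)%:E = v%:E)%E.

Lemma has_mean_cst v : has_mean (fun=> v) v.
Proof.
split; first exact: finite_measure_integrable_cst.
by have P1 := @probability_setT _ _ _ P; rewrite integral_cst// [X in (_ * X)%E]P1 mule1.
Qed.

Lemma has_meanD f g v w : has_mean f v -> has_mean g w ->
  has_mean (fun x => f x + g x) (v + w).
Proof.
move=> [fi fv] [gi gw]; split; first exact: (integrableD measurableT fi gi).
by under eq_integral do rewrite EFinD; rewrite integralD// fv gw.
Qed.

Lemma has_meanZ (k : R) f v : has_mean f v -> has_mean (fun x => k * f x) (k * v).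
Proof.
move=> [fi fv]; split; first exact: (integrableZl measurableT k fi).
by under eq_integral do rewrite EFinM; rewrite integralZl// fv.
Qed.

Lemma has_mean_sum (I : Type) (s : seq I) (f : I -> T -> R) (v : I -> R) :
  (forall i, has_mean (f i) (v i)) ->
  has_mean (fun x => \sum_(i <- s) f i x) (\sum_(i <- s) v i).
Proof.
move=> fv; elim: s => [|i s IH].
  rewrite big_nil (_ : (fun x => _) = fun=> 0); first exact: has_mean_cst.
  by apply/funext => x; rewrite big_nil.
rewrite big_cons (_ : (fun x => _) = fun x => f i x + \sum_(j <- s) f j x).
  exact: has_meanD.
by apply/funext => x; rewrite big_cons.
Qed.

Lemma has_mean_le f g v w : (forall x, f x <= g x) -> has_mean f v -> has_mean g w -> v <= w.
Proof.
move=> fg [fi fv] [gi gw]; rewrite -lee_fin -fv -gw; apply: le_integral => // x _.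
by rewrite lee_fin.
Qed.

Lemma has_mean_exists_le f v w : has_mean f v -> v < w -> exists x, f x <= w.
Proof.
move=> fv vw; apply: contrapT => h.
have : w <= v.
  apply: has_mean_le (has_mean_cst w) fv => x.
  by rewrite leNgt; apply/negP => /ltW fw; apply: h; exists x.
by rewrite leNgt vw.
Qed.

End HasMean.

Section Barron.
Context {R : realType} {d : nat}.
Implicit Types (x y : 'rV[R]_d) (z : R * d.-tuple R) (S : set 'rV[R]_d) (h : 'rV[R]_d -> R).

Definition neuron z x : R := z.1 * relu (dotw z.2 x).
Definition neuron_weight z : R := `|z.1| * l1_tuple z.2.

Lemma l1_tuple_ge0 (w : d.-tuple R) : 0 <= l1_tuple w.
Proof. exact: sumr_ge0. Qed.

Lemma neuron_weight_ge0 z : 0 <= neuron_weight z.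
Proof. by rewrite mulr_ge0 ?l1_tuple_ge0. Qed.

Lemma neuron_lip z x y delta : (forall j, `|x 0 j - y 0 j| <= delta) ->
  `|neuron z x - neuron z y| <= neuron_weight z * delta.
Proof.
move=> xy; rewrite -mulrBr normrM -mulrA ler_wpM2l//.
rewrite (le_trans (relu_lip _ _))// -sumrB mulr_suml.
rewrite (le_trans (ler_norm_sum _ _ _))//; apply: ler_sum => j _.
by rewrite -mulrBr normrM ler_wpM2l.
Qed.

Lemma neuron_le z x : (forall j, `|x 0 j| <= 1) -> `|neuron z x| <= neuron_weight z.
Proof.
move=> x1; have := @neuron_lip z x 0 1; rewrite mulr1.
have -> : neuron z 0 = 0.
  rewrite /neuron /dotw big1 ?/relu ?maxxx ?mulr0// => j _; by rewrite mxE mulr0.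
by rewrite subr0; apply => j; rewrite mxE subr0.
Qed.

Lemma measurable_neuron_weight : measurable_fun setT neuron_weight.
Proof.
apply: measurable_funM; first exact: measurableT_comp.
rewrite (_ : (fun z => _) = fun z : R * d.-tuple R => \sum_(i < d) `|tnth z.2 i|)//.
apply: measurable_sum => i; apply: measurableT_comp => //.
exact: (measurableT_comp (measurable_tnth i)).
Qed.

Lemma barron_moment S h (rho : probability (R * d.-tuple R)%type R) (b : R) :
  (\int[rho]_z ((z.1 ^+ 2 * l1_tuple z.2 ^+ 2)%:E) < b%:E)%E ->
  exists2 M, M < b & has_mean rho (fun z => neuron_weight z ^+ 2) M.
Proof.
rewrite (_ : (fun z => _) = fun z => (neuron_weight z ^+ 2)%:E); last first.
  by apply/funext => z; rewrite exprMn real_normK ?num_real.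
move=> Ib; have I0 : (0 <= \int[rho]_z (neuron_weight z ^+ 2)%:E)%E.
  by apply: integral_ge0 => z _; rewrite lee_fin sqr_ge0.
have Ifin : (\int[rho]_z (neuron_weight z ^+ 2)%:E)%E \is a fin_num.
  by rewrite ge0_fin_numE// (lt_trans Ib)// ltry.
exists (fine (\int[rho]_z (neuron_weight z ^+ 2)%:E)%E); first by rewrite -lte_fin fineK.
split; last by rewrite fineK.
apply/integrableP; split.
  by apply/measurable_EFinP; apply: measurable_funX; exact: measurable_neuron_weight.
under eq_integral => z _ do rewrite /= ger0_norm ?sqr_ge0//.
by rewrite (lt_trans Ib)// ltry.
Qed.

Lemma barron_rep_mean S h rho x : barron_rep S h rho -> S x ->
  has_mean rho (neuron^~ x) (h x).
Proof. by move=> hrep /hrep. Qed.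

(** A representing measure with finite second moment [M] has mean neuron weight at most [1 + M], by
    [t <= 1 + t ^+ 2]. The size of the constant is immaterial, as refining the cells absorbs it. *)
Lemma barron_lip S h (B : R) : barron_sq S h = B%:E -> exists2 Lr, 0 <= Lr &
  forall x y delta, S x -> S y -> 0 <= delta -> (forall j, `|x 0 j - y 0 j| <= delta) ->
  `|h x - h y| <= Lr * delta.
Proof.
move=> BE; have : (barron_sq S h < (B + 1)%:E)%E by rewrite BE lte_fin ltrDl.
move=> /ereal_inf_lt[_ [rho hrep <-]] /(barron_moment S h)[M _ hM].
have M0 : 0 <= M.
  by apply: has_mean_le (has_mean_cst rho 0) hM => z; exact: sqr_ge0.
exists (1 + M); first by rewrite addr_ge0.
have key x y delta : S x -> S y -> 0 <= delta -> (forall j, `|x 0 j - y 0 j| <= delta) ->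
    h x - h y <= (1 + M) * delta.
  move=> Sx Sy delta0 xy; have hx := barron_rep_mean hrep Sx; have hy := barron_rep_mean hrep Sy.
  rewrite [leRHS]mulrC.
  have := has_mean_le _ (has_meanD hx (has_meanZ (-1) hy))
    (has_meanZ delta (has_meanD (has_mean_cst rho 1) hM)).
  rewrite mulN1r; apply => z; rewrite mulN1r (le_trans (ler_norm _))//.
  rewrite (le_trans (neuron_lip z xy))// mulrC ler_wpM2l//.
  by have := neuron_weight_ge0 z; move: (neuron_weight z) => t t0; nra.
move=> x y delta Sx Sy delta0 xy; rewrite ler_norml key// andbT lerNl opprB key// => j.
by rewrite distrC.
Qed.

(* The neurons are selected one at a time (method of conditional expectations), so
   that only integrals against [rho], and none against a power of it, occur. *)
Lemma monte_carlo S h (rho : probability (R * d.-tuple R)%type R) n (x : 'I_n -> 'rV[R]_d)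
    (om : 'I_n -> R) (M b : R) k :
  (0 < n)%N -> barron_rep S h rho -> has_mean rho (fun z => neuron_weight z ^+ 2) M -> M < b ->
  (forall i, S (x i)) -> (forall i j, `|x i 0 j| <= 1) -> (forall i, 0 <= om i <= 1) ->
  exists zs : k.-tuple (R * d.-tuple R),
    \sum_i om i * (\sum_(z <- zs) (neuron z (x i) - h (x i))) ^+ 2
    + n%:R * \sum_(z <- zs) neuron_weight z ^+ 2 <= 2 * n%:R * k%:R * b.
Proof.
move=> n0 hrep hM Mb Sx x1 om01.
elim: k => [|k [zs hzs]].
  exists [tuple]; rewrite /= big_nil !mulr0 addr0 mul0r big1// => i _.
  by rewrite big_nil expr0n mulr0.
(* [v] is the accumulated error and [beta] the linear coefficient of the new neuron in the squared
   error. The quadratic term and the weight penalty each contribute [n%:R * neuron_weight z ^+ 2],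
   hence the factor 2; the penalty keeps the weights small together with the error. *)
pose v i := \sum_(z <- zs) (neuron z (x i) - h (x i)).
pose beta i := 2 * om i * (v i - h (x i)).
have hG : has_mean rho (fun z => (\sum_i om i * (v i - h (x i)) ^+ 2 +
     \sum_i beta i * neuron z (x i)) + 2 * n%:R * neuron_weight z ^+ 2)
    ((\sum_i om i * (v i - h (x i)) ^+ 2 + \sum_i beta i * h (x i)) + 2 * n%:R * M).
  apply: has_meanD; last exact: has_meanZ.
  apply: has_meanD; first exact: has_mean_cst.
  by apply: has_mean_sum => i; apply: has_meanZ; exact: (barron_rep_mean hrep (Sx i)).
have [|z hz] := has_mean_exists_le hG (w := \sum_i om i * v i ^+ 2 + 2 * n%:R * b).
  apply: ler_ltD; last by rewrite ltr_pM2l// mulr_gt0// ltr0n.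
  rewrite -big_split; apply: ler_sum => i _ /=.
  have -> : om i * (v i - h (x i)) ^+ 2 + beta i * h (x i) = om i * (v i ^+ 2 - h (x i) ^+ 2).
    by rewrite /beta; ring.
  by rewrite ler_wpM2l ?gerBl ?sqr_ge0//; have /andP[] := om01 i.
exists [tuple of z :: zs]; rewrite big_cons.
have hsum : \sum_i om i * (\sum_(z0 <- z :: zs) (neuron z0 (x i) - h (x i))) ^+ 2 <=
    \sum_i om i * (v i - h (x i)) ^+ 2 + \sum_i beta i * neuron z (x i) +
    n%:R * neuron_weight z ^+ 2.
  have -> : n%:R * neuron_weight z ^+ 2 = \sum_(i < n) neuron_weight z ^+ 2.
    by rewrite sumr_const card_ord mulr_natl.
  rewrite -!big_split; apply: ler_sum => i _ /=; rewrite big_cons -/(v i).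
  have /andP[w0 w1] := om01 i; have f1 := neuron_le z (x1 i).
  have -> : om i * (neuron z (x i) - h (x i) + v i) ^+ 2 =
    om i * (v i - h (x i)) ^+ 2 + beta i * neuron z (x i) + om i * neuron z (x i) ^+ 2.
    by rewrite /beta; ring.
  rewrite lerD2l (le_trans (ler_piMl _ w1)) ?sqr_ge0//.
  by rewrite -real_normK ?num_real// ler_pXn2r ?nnegrE ?neuron_weight_ge0.
have -> : 2 * n%:R * k.+1%:R * b = 2 * n%:R * k%:R * b + 2 * n%:R * b :> R.
  by rewrite -natr1; ring.
rewrite -/(v _) in hzs; rewrite mulrDr; move: hz hsum hzs.
move: (\sum_i om i * v i ^+ 2) => s1; rewrite -/v; lra.
Qed.

(** Nonnegativity of the variance bounds [h x ^+ 2] by the second moment of every representing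
    measure. *)
Lemma barron_eq0 S h x : barron_sq S h = 0%:E -> S x -> (forall j, `|x 0 j| <= 1) -> h x = 0.
Proof.
move=> B0 Sx x1; apply/eqP; rewrite -sqrf_eq0; apply/eqP/le_anti; rewrite sqr_ge0 andbT.
apply/ler_addgt0Pr => eps eps0; rewrite add0r.
have : (barron_sq S h < eps%:E)%E by rewrite B0 lte_fin.
move=> /ereal_inf_lt[_ [rho hrep <-]] /(barron_moment S h)[M Meps hM].
have hx := barron_rep_mean hrep Sx; rewrite (le_trans _ (ltW Meps))//.
rewrite -subr_ge0 -[X in M - X]opprK opprK.
have := has_mean_le _ (has_mean_cst rho 0)
  (has_meanD (has_meanD hM (has_meanZ (- 2 * h x) hx)) (has_mean_cst rho (h x ^+ 2))).
rewrite (_ : M + - 2 * h x * h x + h x ^+ 2 = M - h x ^+ 2); last by ring.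
apply => z; rewrite (@le_trans _ _ ((neuron z x - h x) ^+ 2)) ?sqr_ge0//.
rewrite (_ : _ ^+ 2 = neuron z x ^+ 2 + - 2 * h x * neuron z x + h x ^+ 2); last by ring.
by rewrite !lerD2r -real_normK ?num_real// ler_pXn2r ?nnegrE ?neuron_weight_ge0// neuron_le.
Qed.

(** The constant 4 has one factor 2 from [monte_carlo] and one from a representing measure with
    moment below [2 * B], as the infimum need not be attained. No moment lies strictly below [2 * B]
    if [B] is 0, so that case is separate. *)
Lemma barron_approx S h (B : R) n (x : 'I_n -> 'rV[R]_d) (om : 'I_n -> R) m :
  (0 < n)%N -> (0 < m)%N -> barron_sq S h = B%:E ->
  (forall i, S (x i)) -> (forall i j, `|x i 0 j| <= 1) -> (forall i, 0 <= om i <= 1) ->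
  exists zs : 'I_m -> R * d.-tuple R,
    \sum_i om i * (m%:R^-1 * \sum_j neuron (zs j) (x i) - h (x i)) ^+ 2 <= 4 * n%:R * B / m%:R
    /\ (m%:R^-1 * \sum_j neuron_weight (zs j)) ^+ 2 <= 4 * B.
Proof.
move=> n0 m0 BE Sx x1 om01.
have m0' : 0 < m%:R :> R by rewrite ltr0n.
have n0' : 0 < n%:R :> R by rewrite ltr0n.
have B0 : 0 <= B.
  rewrite -lee_fin -BE; apply: le_ereal_inf_tmp => _ [rho _ <-].
  by apply: integral_ge0 => z _; rewrite lee_fin mulr_ge0 ?sqr_ge0.
move: B0; rewrite le_eqVlt => /predU1P[B0|B0].
  exists (fun=> (0, [tuple 0 | _ < d])); rewrite -B0 !mulr0 mul0r.
  have nw0 : neuron_weight (0, [tuple 0 | _ < d]) = 0 by rewrite /neuron_weight normr0 mul0r.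
  rewrite [X in _ * X]big1 ?mulr0 ?expr0n//; split=> //.
  rewrite big1// => i _; rewrite big1; last by move=> j _; rewrite /neuron mul0r.
  by rewrite (barron_eq0 _ (Sx i) (x1 i)) ?BE -?B0// mulr0 subr0 expr0n mulr0.
have : (barron_sq S h < (2 * B)%:E)%E by rewrite BE lte_fin; lra.
move=> /ereal_inf_lt[_ [rho hrep <-]] /(barron_moment S h)[M MB hM].
have [zs] := monte_carlo m n0 hrep hM MB Sx x1 om01.
rewrite big_tuple => hzs; exists (tnth zs).
set e := \sum_i _ in hzs; set W := \sum_j _ in hzs.
have e0 : 0 <= e.
  by apply: sumr_ge0 => i _; rewrite mulr_ge0 ?sqr_ge0//; have /andP[] := om01 i.
have W0 : 0 <= W by apply: sumr_ge0 => j _; rewrite sqr_ge0.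
split.
  have -> : \sum_i om i * (m%:R^-1 * \sum_j neuron (tnth zs j) (x i) - h (x i)) ^+ 2 =
      (m%:R ^+ 2)^-1 * e.
    rewrite mulr_sumr; apply: eq_bigr => i _; rewrite big_tuple sumrB sumr_const card_ord.
    by rewrite -mulr_natl; field; rewrite gt_eqF.
  rewrite ler_pdivrMl ?exprn_gt0//.
  rewrite (_ : m%:R ^+ 2 * (4 * n%:R * B / m%:R) = 4 * n%:R * m%:R * B); last first.
    by field; rewrite gt_eqF.
  have : 0 <= n%:R * W by rewrite mulr_ge0// ltW.
  by move: hzs; rewrite (_ : 2 * n%:R * m%:R * (2 * B) = 4 * n%:R * m%:R * B); [lra|ring].
have hW : W <= 4 * m%:R * B.
  rewrite -(ler_pM2l n0'); move: hzs.
  by rewrite (_ : 2 * n%:R * m%:R * (2 * B) = n%:R * (4 * m%:R * B)); [lra|ring].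
have CS : (\sum_j neuron_weight (tnth zs j)) ^+ 2 <= m%:R * W.
  by have := sqr_sum_le (fun j => neuron_weight (tnth zs j)); rewrite card_ord.
rewrite exprMn exprVn ler_pdivrMl ?exprn_gt0// (le_trans CS)//.
by rewrite expr2 -mulrA ler_pM2l//; move: hW; rewrite mulrCA mulrA.
Qed.

End Barron.

(** * The comparison network *)

(** Lets the hidden vector and the path vector run through the layers in parallel under an invariant
    that knows the layer index. *)
Lemma foldl_enum_ind (L : nat) (T1 T2 : Type) (f1 : T1 -> 'I_L -> T1) (f2 : T2 -> 'I_L -> T2)
    (Inv : nat -> T1 -> T2 -> Prop) x1 x2 :
  Inv 0 x1 x2 ->
  (forall (l : 'I_L) y1 y2, Inv l y1 y2 -> Inv l.+1 (f1 y1 l) (f2 y2 l)) ->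
  Inv L (foldl f1 x1 (enum 'I_L)) (foldl f2 x2 (enum 'I_L)).
Proof.
move=> Inv0 InvS.
suff h (s : seq 'I_L) k y1 y2 : map val s = iota k (size s) -> Inv k y1 y2 ->
    Inv (k + size s)%N (foldl f1 y1 s) (foldl f2 y2 s).
  have := h (enum 'I_L) 0 x1 x2; rewrite -cardE card_ord add0n; apply => //.
  by rewrite val_enum_ord.
elim: s k y1 y2 => [|l s IH] k y1 y2 /=; first by rewrite addn0.
by move=> [lk /IH sk] Ik; rewrite -addSnnS; apply: sk; rewrite -lk; apply: InvS; rewrite lk.
Qed.

Lemma sum_insub (R : nmodType) (n1 n2 : nat) (F : 'I_n1 -> 'I_n2 -> R) (le12 : (n1 <= n2)%N) :
  \sum_(i < n2) (if insub (i : nat) is Some p then F p i else 0) =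
  \sum_(p < n1) F p (widen_ord le12 p).
Proof.
rewrite (bigID (fun i : 'I_n2 => i < n1)%N) /= [X in _ + X]big1 ?addr0 => [|i]; last first.
  by case: insubP => //= p ->.
rewrite (big_ord_narrow le12); apply: eq_bigr => p _.
by rewrite (_ : insub _ = Some p)//; exact: valK.
Qed.

Lemma sum_mxvec (R : nmodType) (q m : nat) (F : 'I_(q * m) -> R) :
  \sum_k F k = \sum_i \sum_j F (mxvec_index i j).
Proof.
rewrite pair_bigA (reindex (uncurry (@mxvec_index q m))) /=.
  by apply: eq_bigr => -[i j].
exact: curry_mxvec_bij.
Qed.

Lemma sum_delta (R : pzSemiRingType) (n k : nat) (F : 'I_n.+1 -> R) : (k <= n)%N ->
  \sum_(i < n.+1) (i == k :> nat)%:R * F i = F (inord k).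
Proof.
move=> kn; rewrite (bigD1 (inord k))//= inordK// eqxx mul1r big1 ?addr0// => i ik.
suff -> : (i == k :> nat) = false by rewrite mul0r.
by apply/negbTE; apply: contra ik => /eqP <-; rewrite inord_val.
Qed.

Lemma max_act_attained (R : realType) alpha (F : 'I_(2 ^ alpha) -> R) :
  exists a, max_act F = F a.
Proof.
rewrite /max_act; elim/big_ind: _ => [|x y [a ->] [b ->]|a _]; first by exists (act0 alpha).
  by rewrite /Num.max; case: ifP; [exists b|exists a].
by exists a.
Qed.

Section BellmanNet.
Context {R : realType} {alpha d m : nat}.
Variables (zs : 'I_(2 ^ alpha) -> 'I_m -> R * d.-tuple R) (a : 'I_(2 ^ alpha)) (c : R).

Local Notation K := (2 ^ alpha)%N.
Local Notation Q := (6 ^ alpha + 1)%N.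
Local Notation N := (d + 2 ^ alpha)%N.

Definition mc_approx b (x : 'rV[R]_d) : R := m%:R^-1 * \sum_j neuron (zs b j) x.
Definition mc_weight b : R := m%:R^-1 * \sum_j neuron_weight (zs b j).

Lemma mc_weight_ge0 b : 0 <= mc_weight b.
Proof. by rewrite mulr_ge0 ?invr_ge0// sumr_ge0// => j _; exact: neuron_weight_ge0. Qed.

(* Hidden coordinates: [0 .. d-1] hold the input, [d + b] the tournament slot of
   action [b], and [d + 2 ^ alpha] a copy of the approximation for the action [a]. *)
Definition slot_coef (i : 'I_N.+1) (b : 'I_K) : R :=
  (i == d + b :> nat)%:R + ((b == a) && (i == N :> nat))%:R.

(** Row [k] encodes a pair (block [q], neuron [j]). Blocks beyond the number of actions are zero and
    pad the layer to the prescribed width. *)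
Definition approx_W : 'M[R]_(Q * m, N.+1) := \matrix_(k, i)
  mxvec (\matrix_(q < Q, j < m) if insub (q : nat) is Some b
    then (if insub (i : nat) is Some p then tnth (zs b j).2 p else 0) else 0) 0 k.

Definition approx_U : 'M[R]_(N.+1, Q * m) := \matrix_(i, k)
  mxvec (\matrix_(q < Q, j < m) if insub (q : nat) is Some b
    then slot_coef i b * (m%:R^-1 * (zs b j).1) else 0) 0 k.

(** Neuron [k] computes the positive part of slot [half + k] minus slot [k]; added back to slot [k]
    by the residual connection, it leaves the maximum of the two. *)
Definition play_W (half : nat) : 'M[R]_(Q * m, N.+1) := \matrix_(k, i)
  ((k < half)%N%:R * ((i == d + (half + k) :> nat)%:R - (i == d + k :> nat)%:R)).

Definition play_U (half : nat) : 'M[R]_(N.+1, Q * m) := \matrix_(i, k)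
  ((k < half)%N && (i == d + k :> nat))%:R.

(** The output adds [c] times slot 0, which holds the winner, to the separate copy for action [a],
    whose own slot the tournament may overwrite. *)
Definition bellman_net : resnet_param R d (Q * m) N.+1 alpha.+1 :=
  @ResnetParam R d (Q * m) N.+1 alpha.+1
    (\col_i ((i == N :> nat)%:R + c * (i == d :> nat)%:R))
    (\matrix_(i, p) (i == p :> nat)%:R)
    (fun l => if l == 0 :> nat then approx_W else play_W (2 ^ (alpha - l)))
    (fun l => if l == 0 :> nat then approx_U else play_U (2 ^ (alpha - l))).

Lemma leq_KQ : (K <= Q)%N.
Proof. by rewrite addn1 leqW//; elim: alpha => // n IH; rewrite !expnS leq_mul. Qed.

(** Covers two computations at once: [f] is [relu] and [sg] the identity for the hidden values, [f]
    the identity and [sg] the absolute value for the path norm. *)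
Lemma approx_layer_sum (i : 'I_N.+1) (f : R -> R) (sg : R -> R) (h : 'I_N.+1 -> R) :
  f 0 = 0 -> (forall x y, sg (x * y) = sg x * sg y) -> sg 0 = 0 ->
  \sum_k sg (approx_U i k) * f (\sum_j sg (approx_W k j) * h j) =
  \sum_(b < K) sg (slot_coef i b) * \sum_j sg m%:R^-1 * sg (zs b j).1 *
    f (\sum_(p < d) sg (tnth (zs b j).2 p) * h (inord p)).
Proof.
move=> f0 sgM sg0; rewrite sum_mxvec.
pose G (b : 'I_K) (q : 'I_Q) := sg (slot_coef i b) * \sum_j sg m%:R^-1 * sg (zs b j).1 *
    f (\sum_(p < d) sg (tnth (zs b j).2 p) * h (inord p)).
rewrite -(sum_insub G leq_KQ); apply: eq_bigr => q _; rewrite /G.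
case E : (insub (q : nat)) => [b|]; last first.
  by rewrite big1// => j _; rewrite !mxE mxvecE mxE E sg0 mul0r.
rewrite mulr_sumr; apply: eq_bigr => j _.
rewrite mxE mxvecE mxE E !sgM -!mulrA; congr (_ * (_ * (_ * f _))).
have le_dN : (d <= N.+1)%N by rewrite leqW// leq_addr.
pose H (p : 'I_d) (i0 : 'I_N.+1) := sg (tnth (zs b j).2 p) * h i0.
transitivity (\sum_(p < d) H p (widen_ord le_dN p)).
  rewrite -(sum_insub H); apply: eq_bigr => i0 _; rewrite mxE mxvecE mxE E.
  by case: insubP => [p _ _|]; rewrite ?sg0 ?mul0r.
by apply: eq_bigr => p _; congr (_ * h _); apply: val_inj; rewrite /= inordK// ltnS ltnW// ltn_addr.
Qed.

Lemma inord_nat k : (k <= N)%N -> (inord k : 'I_N.+1) = k :> nat.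
Proof. by move=> kN; rewrite inordK. Qed.

Lemma slot_coef_copy b : slot_coef (inord N) b = (b == a)%:R.
Proof.
rewrite /slot_coef inord_nat// eqxx andbT eqn_add2l (gtn_eqF (ltn_ord b)).
by rewrite add0r.
Qed.

Lemma slot_coef_slot (b b' : 'I_K) : slot_coef (inord (d + b)) b' = (b' == b)%:R.
Proof.
have bN := ltn_ord b; rewrite /slot_coef inord_nat ?leq_add2l 1?ltnW// !eqn_add2l.
by rewrite (ltn_eqF bN) andbF addr0 eq_sym.
Qed.

Lemma approx_layer_value (h : 'cV[R]_N.+1) (x : 'rV[R]_d) :
  (forall p : 'I_d, h (inord p) 0 = x 0 p) ->
  forall i, \sum_k approx_U i k * relu (\sum_j approx_W k j * h j 0) =
    \sum_b slot_coef i b * mc_approx b x.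
Proof.
move=> hx i; have := @approx_layer_sum i (@relu R) id (h ^~ 0) _ _ erefl.
rewrite /= => ->//; last by rewrite /relu maxxx.
apply: eq_bigr => b _; congr (_ * _); rewrite /mc_approx mulr_sumr; apply: eq_bigr => j _.
rewrite /neuron /dotw -mulrA; congr (_ * (_ * relu _)).
by apply: eq_bigr => p _; rewrite hx.
Qed.

Lemma approx_layer_path (p : 'cV[R]_N.+1) :
  (forall q : 'I_d, p (inord q) 0 = 1) ->
  forall i, \sum_k `|approx_U i k| * \sum_j `|approx_W k j| * p j 0 =
    \sum_b slot_coef i b * mc_weight b.
Proof.
move=> hp i; have := @approx_layer_sum i id Num.norm (p ^~ 0) erefl (@normrM _) (normr0 _).
rewrite /= => ->; apply: eq_bigr => b _; rewrite ger0_norm ?addr_ge0//; congr (_ * _).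
rewrite /mc_weight mulr_sumr; apply: eq_bigr => j _.
rewrite ger0_norm ?invr_ge0// /neuron_weight /l1_tuple -mulrA; congr (_ * (_ * _)).
by apply: eq_bigr => q _; rewrite hp mulr1.
Qed.

Lemma sum_indicator (F : 'I_K -> R) b : \sum_b' (b' == b)%:R * F b' = F b.
Proof. by rewrite (bigD1 b)//= eqxx mul1r big1 ?addr0// => b' /negPf ->; rewrite mul0r. Qed.

Section Play.
Variable half : nat.
Hypotheses (m0 : (0 < m)%N) (halfK : (half.*2 <= K)%N).

Lemma leq_half k : (k < half)%N -> (half + k <= K)%N.
Proof. by move=> kh; rewrite (leq_trans _ halfK)// -addnn leq_add2l ltnW. Qed.

Lemma ltn_half_width k : (k < half)%N -> (k < Q * m)%N.
Proof.
move=> kh; rewrite (leq_trans kh)// (leq_trans _ (leq_pmulr Q m0))//.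
by rewrite (leq_trans _ leq_KQ)// (leq_trans _ halfK)// -addnn leq_addr.
Qed.

Lemma play_layer_sum (i : nat) (F : 'I_(Q * m) -> R) (kh : (i < half)%N) :
  \sum_k play_U half (inord (d + i)) k * F k = F (Ordinal (ltn_half_width kh)).
Proof.
have iN : (d + i <= N)%N by rewrite leq_add2l (leq_trans _ (leq_half kh))// leq_addl.
rewrite (bigD1 (Ordinal (ltn_half_width kh)))//= big1 => [|k].
  by rewrite mxE inord_nat//= kh eqxx mul1r addr0.
rewrite mxE inord_nat// eqn_add2l => kE; rewrite (_ : _ && _ = false) ?mul0r//.
apply/negbTE; rewrite negb_and; apply/orP; right; apply: contra kE => /eqP ik.
by apply/eqP/val_inj.
Qed.

Lemma play_layer_copy (F : 'I_(Q * m) -> R) : \sum_k play_U half (inord N) k * F k = 0.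
Proof.
rewrite big1// => k _; rewrite mxE inord_nat// eqn_add2l.
case: ltnP => kh; rewrite ?mul0r//= gtn_eqF ?mul0r//.
by rewrite (leq_trans _ (leq_half kh))// -add1n leq_add2r (leq_ltn_trans (leq0n k) kh).
Qed.

Lemma play_W_value (k : 'I_(Q * m)) (h : 'cV[R]_N.+1) : (k < half)%N ->
  \sum_j play_W half k j * h j 0 = h (inord (d + (half + k))) 0 - h (inord (d + k)) 0.
Proof.
move=> kh; have kK := leq_half kh.
under eq_bigr do rewrite mxE kh mul1r mulrBl.
by rewrite sumrB !(@sum_delta _ N _ (fun j => h j 0)) ?leq_add2l// (leq_trans _ kK)// leq_addl.
Qed.

Lemma play_W_path (k : 'I_(Q * m)) (p : 'cV[R]_N.+1) : (k < half)%N ->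
  (forall j, 0 <= p j 0) ->
  \sum_j `|play_W half k j| * p j 0 <= p (inord (d + (half + k))) 0 + p (inord (d + k)) 0.
Proof.
move=> kh p0; have kK := leq_half kh.
have kK' : (k <= K)%N by rewrite (leq_trans _ kK)// leq_addl.
rewrite -(@sum_delta _ N (d + (half + k)) (fun j => p j 0)) ?leq_add2l//.
rewrite -(@sum_delta _ N (d + k) (fun j => p j 0)) ?leq_add2l// -big_split /=.
apply: ler_sum => j _; rewrite mxE kh mul1r -mulrDl ler_wpM2r//.
by rewrite (le_trans (ler_normB _ _))// !normr_nat.
Qed.

End Play.

(* After layer [k'] the slots [b < 2 ^ (alpha - k')] are still in the tournament;
   each round at most multiplies the total path norm of these slots by 4. *)
Definition net_invariant (x : 'rV[R]_d) (k : nat) (h p : 'cV[R]_N.+1) : Prop :=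
  (forall i, 0 <= p i 0) /\
  if k is k'.+1 then
    [/\ h (inord N) 0 = mc_approx a x,
     (forall b, (b < 2 ^ (alpha - k'))%N -> h (inord (d + b)) 0 <= max_act (mc_approx^~ x)),
     (exists2 b, (b < 2 ^ (alpha - k'))%N & h (inord (d + b)) 0 = max_act (mc_approx^~ x)),
     p (inord N) 0 = 3 * mc_weight a &
     \sum_(b < 2 ^ (alpha - k')) p (inord (d + b)) 0 <= 4 ^+ k' * (3 * \sum_b mc_weight b)]
  else
    [/\ forall q : 'I_d, h (inord q) 0 = x 0 q, forall q : 'I_d, p (inord q) 0 = 1,
      forall b, (b <= K)%N -> h (inord (d + b)) 0 = 0 &
      forall b, (b <= K)%N -> p (inord (d + b)) 0 = 0].

Lemma net_invariantS x (l : 'I_alpha.+1) h p : (0 < m)%N -> net_invariant x l h p ->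
  net_invariant x l.+1 (layer bellman_net h l) (path_layer bellman_net p l).
Proof.
move=> m0 [p0 inv]; split; first exact: path_layer_ge0.
case: l inv => -[|l] ll /=.
  move=> [hx px h0 pz]; set l0 := Ordinal ll.
  (* The inequality is not strict because [b = K] is the coordinate of the copy. *)
  have hE b : (b <= K)%N -> layer bellman_net h l0 (inord (d + b)) 0 =
      \sum_b' slot_coef (inord (d + b)) b' * mc_approx b' x.
    by move=> bK; rewrite layerE (h0 _ bK) add0r (approx_layer_value hx).
  have pE b : (b <= K)%N -> path_layer bellman_net p l0 (inord (d + b)) 0 =
      3 * \sum_b' slot_coef (inord (d + b)) b' * mc_weight b'.
    by move=> bK; rewrite path_layerE (pz _ bK) add0r (approx_layer_path px).
  have hb (b : 'I_K) : layer bellman_net h l0 (inord (d + b)) 0 = mc_approx b x.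
    rewrite hE 1?ltnW//; under eq_bigr do rewrite slot_coef_slot.
    exact: (sum_indicator (mc_approx^~ x)).
  rewrite subn0; split.
  - rewrite hE//; under eq_bigr do rewrite slot_coef_copy.
    exact: (sum_indicator (mc_approx^~ x)).
  - by move=> b bK; rewrite (hb (Ordinal bK)); exact: (max_act_ge (mc_approx^~ x)).
  - have [b bM] := max_act_attained (mc_approx^~ x).
    by exists b => //; rewrite hb bM.
  - rewrite pE//; under eq_bigr do rewrite slot_coef_copy.
    by rewrite (sum_indicator mc_weight).
  - rewrite mul1r mulr_sumr; apply: ler_sum => b _; rewrite pE 1?ltnW//.
    by under eq_bigr do rewrite slot_coef_slot; rewrite (sum_indicator mc_weight).
set half := (2 ^ (alpha - l.+1))%N; set ll' := Ordinal ll.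
have twice : (2 ^ (alpha - l) = half + half)%N.
  by rewrite /half addnn -mul2n -expnS -subSn.
have halfK : (half.*2 <= K)%N.
  by rewrite -addnn -twice leq_exp2l// leq_subr.
rewrite twice => -[hc hle [b bh hM] pc psum].
have hT b' (bh' : (b' < half)%N) : layer bellman_net h ll' (inord (d + b')) 0 =
    Num.max (h (inord (d + b')) 0) (h (inord (d + (half + b'))) 0).
  rewrite layerE /= (play_layer_sum m0 halfK _ bh') play_W_value//=.
  by rewrite /relu addr_maxr addr0 addrC subrK maxC.
have pT b' (bh' : (b' < half)%N) : path_layer bellman_net p ll' (inord (d + b')) 0 <=
    4 * (p (inord (d + b')) 0 + p (inord (d + (half + b'))) 0).
  rewrite path_layerE /=.
  rewrite (eq_bigr (fun k => play_U half (inord (d + b')) k *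
      \sum_j `|play_W half k j| * p j 0)) => [|k _]; last by rewrite mxE normr_nat.
  rewrite (play_layer_sum m0 halfK _ bh').
  have := @play_W_path half halfK (Ordinal (ltn_half_width m0 halfK bh')) p bh' p0 => /=.
  by have := p0 (inord (d + (half + b'))); lra.
split.
- by rewrite layerE /= play_layer_copy// addr0.
- by move=> b' bh'; rewrite hT// ge_max !hle ?ltn_add2l ?ltn_addr.
(* A maximal slot in the upper half passes its value on to its opponent [b - half]. *)
- have [bh1|bh1] := ltnP b half.
    by exists b => //; rewrite hT// hM; apply/max_idPl; rewrite hle ?ltn_add2l.
  have bb : (half + (b - half))%N = b by rewrite subnKC.
  have bh2 : (b - half < half)%N by rewrite ltn_subLR.
  by exists (b - half)%N => //; rewrite hT// bb hM; apply/max_idPr; rewrite hle ?ltn_addr.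
- rewrite path_layerE /= (eq_bigr (fun k => play_U half (inord N) k *
      \sum_j `|play_W half k j| * p j 0)) => [|k _]; last by rewrite mxE normr_nat.
  by rewrite play_layer_copy// mulr0 addr0.
- rewrite exprS -mulrA; apply: (le_trans _ (ler_wpM2l _ psum)) => //.
  rewrite big_split_ord /= -big_split mulr_sumr; apply: ler_sum => b' _ /=.
  exact: pT.
Qed.

Lemma net_invariant0 x : net_invariant x 0 (rn_V bellman_net *m x^T)
  (abs_mx (rn_V bellman_net) *m const_mx 1).
Proof.
split; first exact: path_vec0_ge0.
have le_q (q : 'I_d) : (q <= N)%N by rewrite ltnW// ltn_addr.
split.
- move=> q; rewrite mxE (bigD1 q)//= !mxE inord_nat// eqxx mul1r big1 ?addr0// => q' q'q.
  by rewrite !mxE inord_nat// eq_sym (negbTE (q'q : (q' != q :> nat))) mul0r.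
- move=> q; rewrite mxE (bigD1 q)//= !mxE inord_nat// eqxx normr1 mul1r big1 ?addr0// => q' q'q.
  by rewrite !mxE inord_nat// eq_sym (negbTE (q'q : (q' != q :> nat))) normr0 mul0r.
- move=> b bK; rewrite mxE big1// => q _; rewrite mxE inord_nat ?leq_add2l//.
  by rewrite gtn_eqF ?mul0r// ltn_addr.
- move=> b bK; rewrite mxE big1// => q _; rewrite !mxE inord_nat ?leq_add2l//.
  by rewrite gtn_eqF ?normr0 ?mul0r// ltn_addr.
Qed.

Lemma bellman_net_correct x : (0 < m)%N -> 0 <= c ->
  resnet bellman_net x = mc_approx a x + c * max_act (mc_approx^~ x) /\
  path_norm bellman_net <= 3 * mc_weight a + c * (4 ^+ alpha * (3 * \sum_b mc_weight b)).
Proof.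
move=> m0 c0; rewrite path_normE.
have [p0] : net_invariant x alpha.+1 (resnet_hidden bellman_net x) (path_vec bellman_net).
  by apply: foldl_enum_ind; [exact: net_invariant0|move=> l h p; exact: net_invariantS].
rewrite subnn expn0 big_ord1 addn0 => -[hN hle [[|//] _ hM] pN psum].
have uE (F : 'I_N.+1 -> R) : \sum_(i < N.+1) ((i == N :> nat)%:R + c * (i == d :> nat)%:R) * F i =
    F (inord N) + c * F (inord d).
  under eq_bigr do rewrite mulrDl -mulrA.
  by rewrite big_split /= -mulr_sumr !sum_delta// leq_addr.
split.
  rewrite -hN -hM addn0 -(uE (fun i => resnet_hidden bellman_net x i 0)) /resnet mxE.
  by apply: eq_bigr => i _; rewrite !mxE.
rewrite (eq_bigr (fun i : 'I_N.+1 => ((i == N :> nat)%:R + c * (i == d :> nat)%:R) *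
    path_vec bellman_net i 0)) => [|i _]; last first.
  by rewrite mxE ger0_norm// addr_ge0// mulr_ge0.
by rewrite uE pN lerD2l ler_wpM2l.
Qed.

End BellmanNet.

(** * Uniform deviation *)

Lemma measure_finite_disjoint_bigcup (dO : measure_display) (O : measurableType dO) (R : realType)
    (P : probability O R) (I : finType) (Q : pred I) (F : I -> set O) :
  (forall i, measurable (F i)) -> (forall i j w, F i w -> F j w -> i = j) ->
  P (\bigcup_(i in [set i | Q i]) F i) = (\sum_(i | Q i) P (F i))%E.
Proof.
move=> mF dF.
have tF : trivIset [set i | Q i] F by move=> i j _ _ [w [Fi Fj]]; exact: dF Fi Fj.
have fQ : finite_set [set i | Q i] by exact: finite_finset.
rewrite (measure_fin_bigcup P fQ tF (fun i _ => mF i)).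
by rewrite (bigfs _ (index_enum_uniq I))// => i _; rewrite mem_index_enum.
Qed.

(** * Borel sets and grid boxes *)

Section RVMeasurable.
Context {R : realType} {d : nat}.
Implicit Types (B : set 'rV[R]_d).

Lemma rV_measurableI B B' : rV_measurable B -> rV_measurable B' -> rV_measurable (B `&` B').
Proof.
move=> [C [mC ->]] [C' [mC' ->]]; exists (C `&` C'); split; first exact: measurableI.
by rewrite preimage_setI.
Qed.

Lemma rV_measurableT : rV_measurable [set: 'rV[R]_d].
Proof. by exists setT; split; [exact: measurableT|rewrite preimage_setT]. Qed.

(** Half-open sides make the boxes disjoint; the extra index [M] catches coordinates equal to 1. *)
Definition grid_box M (c : {ffun 'I_d -> 'I_M.+1}) : set 'rV[R]_d :=
  [set x | forall j, (c j)%:R <= M%:R * x 0 j < (c j).+1%:R].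

Lemma rV_measurable_grid_box M (c : {ffun 'I_d -> 'I_M.+1}) : rV_measurable (grid_box c).
Proof.
exists (\bigcap_(j in setT) [set t : d.-tuple R | (c j)%:R <= M%:R * tnth t j < (c j).+1%:R]).
split; last first.
  apply/seteqP; split=> x h j.
    by move=> _ /=; rewrite tnth_mktuple.
  by have := h j I; rewrite /= tnth_mktuple.
apply: fin_bigcap_measurable; [exact: finite_finset|move=> j _].
have mf : measurable_fun setT (fun t : d.-tuple R => M%:R * tnth t j).
  by apply: measurable_funM => //; exact: measurable_tnth.
rewrite (_ : [set t | _] = [set: d.-tuple R] `&` (fun t : d.-tuple R => M%:R * tnth t j) @^-1`
  `[(c j)%:R, (c j).+1%:R[%classic); first exact: (mf measurableT).
by apply/seteqP; split=> t /=; rewrite in_itv /=; [|case].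
Qed.

Definition grid_cell M (x : 'rV[R]_d) : {ffun 'I_d -> 'I_M.+1} :=
  [ffun j => inord (Num.truncn (M%:R * x 0 j))].

Lemma grid_cellP M (x : 'rV[R]_d) : (forall j, 0 <= x 0 j <= 1) -> grid_box (grid_cell M x) x.
Proof.
move=> x01 j; have /andP[x0 x1] := x01 j; rewrite ffunE.
have Mx0 : 0 <= M%:R * x 0 j by rewrite mulr_ge0.
rewrite inordK; first exact: truncn_itv.
have Mx1 : M%:R * x 0 j <= M%:R by rewrite ler_piMr.
rewrite ltnS truncn_le_nat; apply: (le_lt_trans Mx1); by rewrite ltr_nat.
Qed.

Lemma grid_box_uniq M (c c' : {ffun 'I_d -> 'I_M.+1}) x : grid_box c x -> grid_box c' x -> c = c'.
Proof.
move=> cx c'x; apply/ffunP => j; apply/val_inj/eqP; rewrite eqn_leq.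
have /andP[h1 h2] := cx j; have /andP[h3 h4] := c'x j.
by apply/andP; split; rewrite -ltnS -(ltr_nat R);
  [exact: le_lt_trans h1 h4|exact: le_lt_trans h3 h2].
Qed.

Lemma grid_box_dist M (c : {ffun 'I_d -> 'I_M.+1}) x y : (0 < M)%N ->
  grid_box c x -> grid_box c y -> forall j, `|x 0 j - y 0 j| <= M%:R^-1.
Proof.
move=> M0 cx cy j; have M0' : 0 < M%:R :> R by rewrite ltr0n.
rewrite -[M%:R^-1]mul1r ler_pdivlMr// -[X in _ * X](gtr0_norm M0') -normrM mulrC mulrBr.
have /andP[h1 h2] := cx j; have /andP[h3 h4] := cy j.
by rewrite ler_norml; move: h2 h4; rewrite -!natr1; lra.
Qed.

End RVMeasurable.

Section UniformDeviation.
Context {R : realType} {alpha d m D L n : nat}.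
Variables (S : set 'rV[R]_d) (gamma dt : R) (r : 'rV[R]_d -> 'I_(2 ^ alpha) -> R).
Variable g : 'rV[R]_d -> 'I_(2 ^ alpha) -> R -> 'rV[R]_d.
Variables (dO : measure_display) (O : measurableType dO) (P : probability O R).
Variables (s : 'I_n -> O -> 'rV[R]_d) (a : 'I_n -> O -> 'I_(2 ^ alpha)).
Variable Lr : R.
Hypotheses (d0 : (0 < d)%N) (n0 : (0 < n)%N) (gamma01 : 0 <= gamma <= 1) (Lr0 : 0 <= Lr).
Hypothesis S01 : forall x, S x -> forall i, 0 <= x ord0 i <= 1.
Hypothesis r1 : forall x b, S x -> `|r x b| <= 1.
Hypothesis rlip : forall b x y delta, S x -> S y -> 0 <= delta ->
  (forall j, `|x 0 j - y 0 j| <= delta) -> `|r x b - r y b| <= Lr * delta.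
Hypothesis gS : forall x b, S x -> S (g x b dt).
Hypothesis mg : forall b B, rV_measurable B ->
  rV_measurable (S `&` (fun x => g x b dt) @^-1` B).
Hypothesis iid : iid_sample S P s a.

Local Notation K := (2 ^ alpha)%N.
Implicit Types (Th : 'I_K -> resnet_param R d m D L).

Lemma admissible_S x b : S x -> admissible_point r g dt x b.
Proof.
move=> Sx; split=> [j|j|]; last exact: r1.
  by have /andP[x0 x1] := S01 Sx j; rewrite ger0_norm.
by have /andP[x0 x1] := S01 (gS b Sx) j; rewrite ger0_norm.
Qed.

(** The residual has Lipschitz constant at most 2 Lambda + [Lr]; division by 3 Lambda + 1 leaves at
    most [1 + Lr], uniformly in [Th]. *)
Lemma scaled_loss_dist Th b x y (delta : R) : S x -> S y -> 0 <= delta ->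
  (forall j, `|x 0 j - y 0 j| <= delta) ->
  (forall j, `|g x b dt 0 j - g y b dt 0 j| <= delta) ->
  scaled_loss r g gamma dt Th x b <= scaled_loss r g gamma dt Th y b + (1 + Lr) * delta.
Proof.
move=> Sx Sy delta0 xy gxy; have Z0 := bellman_scale_gt0 Th.
have L0 := family_path_norm_ge0 Th; have /andP[g0 g1] := gamma01.
have hx := bellman_res_le gamma01 Th (admissible_S b Sx).
have hy := bellman_res_le gamma01 Th (admissible_S b Sy).
have hf : `|resnet (Th b) x - resnet (Th b) y| <= family_path_norm Th * delta.
  by rewrite (le_trans (resnet_lip _ delta0 xy))// ler_wpM2r// path_norm_le_family.
have hm : `|max_act (fun a' => resnet (Th a') (g x b dt)) -
    max_act (fun a' => resnet (Th a') (g y b dt))| <= family_path_norm Th * delta.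
  apply: max_act_dist => a'.
  by rewrite (le_trans (resnet_lip _ delta0 gxy))// ler_wpM2r// path_norm_le_family.
have hgm : `|gamma * (max_act (fun a' => resnet (Th a') (g x b dt)) -
    max_act (fun a' => resnet (Th a') (g y b dt)))| <= family_path_norm Th * delta.
  rewrite normrM (ger0_norm g0) (le_trans (ler_wpM2l g0 hm))//.
  by rewrite ler_piMl// mulr_ge0.
have hr := rlip b Sx Sy delta0 xy.
have hxy : `|bellman_res r g gamma dt Th x b - bellman_res r g gamma dt Th y b| <=
    bellman_scale Th * ((1 + Lr) * delta).
  rewrite /bellman_res (_ : _ - _ = (resnet (Th b) x - resnet (Th b) y) - (r x b - r y b) -
    gamma * (max_act (fun a' => resnet (Th a') (g x b dt)) -
    max_act (fun a' => resnet (Th a') (g y b dt)))); last by ring.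
  rewrite (le_trans (ler_normB _ _))// (le_trans (lerD (ler_normB _ _) (lexx _)))//.
  rewrite (le_trans (lerD (lerD hf hr) hgm))// -!mulrDl mulrA ler_wpM2r//.
  rewrite /bellman_scale; have : 0 <= family_path_norm Th * Lr by rewrite mulr_ge0.
  by lra.
rewrite /scaled_loss; set X := bellman_res _ _ _ _ _ _ _ / _.
set Y := bellman_res _ _ _ _ _ _ _ / _.
have X1 : `|X| <= 1 by rewrite normrM normfV (gtr0_norm Z0) ler_pdivrMr// mul1r.
have Y1 : `|Y| <= 1 by rewrite normrM normfV (gtr0_norm Z0) ler_pdivrMr// mul1r.
have XY : `|X - Y| <= (1 + Lr) * delta.
  by rewrite -mulrBl normrM normfV (gtr0_norm Z0) ler_pdivrMr// mulrC.
rewrite -lerBlDl -mulrBl subr_sqr (le_trans (ler_norm _))// normrM (ger0_norm (_ : 0 <= 2^-1))//.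
rewrite normrM -mulrA (le_trans _ XY)// ler_piMr// ler_pdivrMr// mul1r.
by rewrite (le_trans (ler_normD _ _))//; lra.
Qed.

Section Cells.
Variable M : nat.
Hypothesis M0 : (0 < M)%N.
Local Notation box := {ffun 'I_d -> 'I_M.+1}.

(** Both the state and its successor are confined to boxes: the transition is only measurable in the
    state, so nearby states may have distant successors. *)
Definition state_cell (cc : box * box) b : set 'rV[R]_d :=
  grid_box cc.1 `&` (S `&` (fun x => g x b dt) @^-1` grid_box cc.2).

Lemma rV_measurable_state_cell cc b : rV_measurable (state_cell cc b).
Proof. by apply: rV_measurableI; [|apply: mg]; exact: rV_measurable_grid_box. Qed.

Lemma state_cell_S cc b x : state_cell cc b x -> S x.
Proof. by move=> [_ []]. Qed.

Lemma state_cell_uniq cc cc' b x : state_cell cc b x -> state_cell cc' b x -> cc = cc'.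
Proof.
case: cc cc' => [c1 c2] [c1' c2'] [h1 [_ h2]] [h1' [_ h2']].
by congr (_, _); [exact: grid_box_uniq h1 h1'|exact: grid_box_uniq h2 h2'].
Qed.

Lemma state_cell_cover b x : S x -> exists cc, state_cell cc b x.
Proof.
move=> Sx; exists (grid_cell M x, grid_cell M (g x b dt)).
by split; [|split=> //]; apply: grid_cellP; apply: S01 => //; exact: gS.
Qed.

Lemma scaled_loss_cell Th cc b x y : state_cell cc b x -> state_cell cc b y ->
  scaled_loss r g gamma dt Th x b <= scaled_loss r g gamma dt Th y b + (1 + Lr) / M%:R.
Proof.
move=> [x1 [Sx x2]] [y1 [Sy y2]]; apply: scaled_loss_dist => //.
  exact: grid_box_dist x1 y1.
exact: grid_box_dist x2 y2.
Qed.

Definition first_ord : 'I_n := Ordinal n0.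

(** The law of a sample point is read off [P], so that finiteness and total mass 1 come from a
    probability measure. *)
Definition cell_prob (c : box * box * 'I_K) : R :=
  fine (P (s first_ord @^-1` state_cell c.1 c.2)) / K%:R.

Lemma measurable_state_event i cc b : measurable (s i @^-1` state_cell cc b).
Proof. by have [h _ _ _ _] := iid; apply: h; exact: rV_measurable_state_cell. Qed.

Lemma state_prob i cc b :
  P (s i @^-1` state_cell cc b) = (fine (P (s first_ord @^-1` state_cell cc b)))%:E.
Proof.
have [_ _ h _ _] := iid.
rewrite !h; try exact: rV_measurable_state_cell.
rewrite -(h first_ord); last exact: rV_measurable_state_cell.
by rewrite fineK// fin_num_measure//; exact: measurable_state_event.
Qed.

Lemma unif_prob_state_cell cc b :
  unif_prob S (state_cell cc b) = (fine (P (s first_ord @^-1` state_cell cc b)))%:E.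
Proof.
have [_ _ h _ _] := iid; rewrite -(h first_ord); first exact: state_prob.
exact: rV_measurable_state_cell.
Qed.

Lemma cell_prob_ge0 c : 0 <= cell_prob c.
Proof. by rewrite divr_ge0// fine_ge0. Qed.

Lemma P_in_S i : P (s i @^-1` S) = 1%E.
Proof.
have [_ _ h _ _] := iid.
have mS : rV_measurable S.
  have := @mg (act0 alpha) setT rV_measurableT.
  by rewrite preimage_setT setIT.
rewrite h// (_ : unif_prob S S = unif_prob S setT); last by rewrite /unif_prob setIid setTI.
by rewrite -(h i setT rV_measurableT) preimage_setT probability_setT.
Qed.

Lemma cell_prob_sum1 : \sum_c cell_prob c = 1.
Proof.
rewrite -(pair_bigA _ (fun cc b => cell_prob (cc, b))) exchange_big /=.
rewrite (eq_bigr (fun=> K%:R^-1)) => [|b _].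
  by rewrite sumr_const card_ord -[LHS]mulr_natl divff// pnatr_eq0 -lt0n two_pow_gt0.
rewrite /cell_prob -mulr_suml -[RHS]mul1r; congr (_ / _).
apply: EFin_inj; rewrite -sumEFin -(P_in_S first_ord).
have -> : s first_ord @^-1` S =
    \bigcup_(cc in [set cc | xpredT cc]) (s first_ord @^-1` state_cell cc b).
  apply/seteqP; split=> w /=.
    by move=> /(state_cell_cover b)[cc hcc]; exists cc.
  by move=> [cc _ /state_cell_S].
rewrite measure_finite_disjoint_bigcup//.
- by apply: eq_bigr => cc _; rewrite -(state_prob first_ord).
- by move=> cc; exact: measurable_state_event.
- by move=> cc cc' w; exact: state_cell_uniq.
Qed.

Definition config_event (c : {ffun 'I_n -> box * box * 'I_K}) : set O :=
  \bigcap_i (s i @^-1` state_cell (c i).1 (c i).2 `&` a i @^-1` [set (c i).2]).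

Lemma measurable_config_event c : measurable (config_event c).
Proof.
apply: fin_bigcap_measurable; first exact: finite_finset.
move=> i _; apply: measurableI; first exact: measurable_state_event.
by have [_ h _ _ _] := iid; exact: h.
Qed.

Lemma config_event_uniq c c' w : config_event c w -> config_event c' w -> c = c'.
Proof.
move=> cw c'w; apply/ffunP => i; have [h1 h2] := cw i I; have [h3 h4] := c'w i I.
have b12 : (c i).2 = (c' i).2 by rewrite -h2 -h4.
rewrite [c i]surjective_pairing [c' i]surjective_pairing b12; congr (_, _).
by rewrite -b12 in h3; exact: state_cell_uniq h1 h3.
Qed.

Lemma config_event_prob c : P (config_event c) = (prod_weight cell_prob c)%:E.
Proof.
have [_ _ _ hb hind] := iid.
rewrite /config_event (hind (fun i => state_cell (c i).1 (c i).2) (fun i => [set (c i).2]));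
  last by move=> i; exact: rV_measurable_state_cell.
rewrite /prod_weight -prodEFin; apply: eq_bigr => i _.
by rewrite hb state_prob -EFinM.
Qed.

Definition cell_rep (x0 : 'rV[R]_d) (c : box * box * 'I_K) : 'rV[R]_d :=
  if pselect (state_cell c.1 c.2 !=set0) is left h then sval (cid h) else x0.

Lemma cell_repP x0 c x : state_cell c.1 c.2 x -> state_cell c.1 c.2 (cell_rep x0 c).
Proof.
move=> cx; rewrite /cell_rep; case: pselect => [h|[]]; last by exists x.
by case: cid.
Qed.

Lemma cell_rep_S x0 c : S x0 -> S (cell_rep x0 c).
Proof.
move=> Sx0; rewrite /cell_rep; case: pselect => // h.
by case: cid => x /= /state_cell_S.
Qed.

Lemma pop_loss_le x0 Th :
  (pop_loss S r g gamma dt Th <=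
    (bellman_scale Th ^+ 2 * (pmean cell_prob
       (fun Th c => scaled_loss r g gamma dt Th (cell_rep x0 c) c.2) Th +
       (1 + Lr) / M%:R))%:E)%E.
Proof.
have Z0 := bellman_scale_gt0 Th.
pose k (cc : box * box) b := bellman_scale Th ^+ 2 *
  (scaled_loss r g gamma dt Th (cell_rep x0 (cc, b)) b + (1 + Lr) / M%:R).
have k0 cc b : 0 <= k cc b.
  by rewrite mulr_ge0 ?sqr_ge0// addr_ge0 ?divr_ge0 ?addr_ge0 ?sqr_ge0.
apply: (@le_trans _ _ (\sum_(b < K) (K%:R^-1)%:E *
    \sum_cc (k cc b)%:E * unif_prob S (state_cell cc b))%E).
  apply: lee_sum => b _; rewrite lee_wpmul2l// ?lee_fin ?invr_ge0//.
  apply: unif_expect_le => //.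
  - move=> cc; apply: rV_measurableI; first exact: rV_measurable_state_cell.
    by have := @mg b setT rV_measurableT; rewrite preimage_setT setIT.
  - by move=> x; rewrite divr_ge0 ?sqr_ge0.
  move=> x Sx; have [cc hcc] := state_cell_cover b Sx; exists cc => //.
  have := scaled_loss_cell Th hcc (@cell_repP x0 (cc, b) x hcc).
  rewrite /k -(ler_pM2l (exprn_gt0 2 Z0)); apply: le_trans.
  by rewrite /scaled_loss expr_div_n mulrA [_ ^+ 2 * (_ / _)]mulrC divfK// expf_neq0 ?gt_eqF.
under eq_bigr => b _.
  under eq_bigr => cc _ do rewrite unif_prob_state_cell -EFinM.
  rewrite sumEFin -EFinM.
  over.
rewrite sumEFin lee_fin le_eqVlt; apply/orP; left; apply/eqP.
transitivity (\sum_cc \sum_(b < K) cell_prob (cc, b) * k cc b).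
  rewrite exchange_big /=; apply: eq_bigr => b _; rewrite mulr_sumr; apply: eq_bigr => cc _.
  by rewrite /cell_prob /=; ring.
rewrite (pair_bigA _ (fun cc b => cell_prob (cc, b) * k cc b)) /=.
rewrite /k; move: ((1 + Lr) / M%:R) => e.
rewrite -[X in _ * (_ + X)]mulr1 -cell_prob_sum1 /pmean mulr_sumr -big_split mulr_sumr.
by apply: eq_bigr => -[cc b] _ /=; ring.
Qed.

Lemma emp_loss_ge x0 Th c w : config_event c w ->
  bellman_scale Th ^+ 2 * (n%:R^-1 *
    (\sum_i scaled_loss r g gamma dt Th (cell_rep x0 (c i)) (c i).2) - (1 + Lr) / M%:R) <=
  emp_loss r g gamma dt (fun i => s i w) (fun i => a i w) Th.
Proof.
move=> cw; have Z0 := bellman_scale_gt0 Th; have n0' : 0 < n%:R :> R by rewrite ltr0n.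
have -> : emp_loss r g gamma dt (fun i => s i w) (fun i => a i w) Th =
  bellman_scale Th ^+ 2 * (n%:R^-1 * \sum_i scaled_loss r g gamma dt Th (s i w) (a i w)).
  rewrite /emp_loss invfM -mulrA [RHS]mulrCA [LHS]mulrCA; congr (_ * _).
  rewrite !mulr_sumr; apply: eq_bigr => i _; rewrite /scaled_loss expr_div_n.
  by field; rewrite gt_eqF.
rewrite ler_pM2l ?exprn_gt0// lerBlDr -ler_pdivlMl ?invr_gt0// invrK mulrDr mulVKf ?gt_eqF//.
rewrite [n%:R * _](_ : _ = \sum_(i < n) (1 + Lr) / M%:R); last first.
  by rewrite sumr_const card_ord mulr_natl.
rewrite -big_split; apply: ler_sum => i _ /=; have [h1 h2] := cw i I.
by rewrite h2; apply: scaled_loss_cell (cell_repP x0 h1) h1.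
Qed.

End Cells.

(** The gap between [eta] and [eta'] pays for the discretization, [(1 + Lr) / M%:R] in the
    population loss and again in the empirical loss. The event is a finite union of cell
    configurations of the sample. *)
Lemma uniform_deviation (t eta eta' delta : R) : 0 <= t -> eta < eta' ->
  3 ^+ (L + 2 * K) * (8 * d%:R) * expR (8 * t ^+ 2 * n%:R - t * n%:R * eta) <= delta ->
  exists E : set O, measurable E /\ ((1 - delta)%:E <= P E)%E /\
  forall w, E w -> (forall i, S (s i w)) /\
  forall Th, (pop_loss S r g gamma dt Th <=
    (emp_loss r g gamma dt (fun i => s i w) (fun i => a i w) Th +
     bellman_scale Th ^+ 2 * eta')%:E)%E.
Proof.
move=> t0 eta12 hdelta; have n0' : 0 < n%:R :> R by rewrite ltr0n.
have [x0 Sx0] : S !=set0.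
  apply: contrapT => /set0P/negP; rewrite negbK => /eqP S0.
  have := P_in_S first_ord; rewrite S0 preimage_set0 measure0 => /eqP.
  by rewrite eqe eq_sym oner_eq0.
have [M M0 hM] : exists2 M, (0 < M)%N & 2 * ((1 + Lr) / M%:R) <= eta' - eta.
  have e0 : 0 < eta' - eta by rewrite subr_gt0.
  exists (Num.truncn (2 * (1 + Lr) / (eta' - eta))).+1 => //.
  rewrite mulrA ler_pdivrMr// [leRHS]mulrC -ler_pdivrMr// ltW//.
  have q0 : 0 <= 2 * (1 + Lr) / (eta' - eta).
    by apply: divr_ge0 (ltW e0); rewrite mulr_ge0 ?addr_ge0.
  by have /andP[] := truncn_itv q0.
pose C := ({ffun 'I_d -> 'I_M.+1} * {ffun 'I_d -> 'I_M.+1} * 'I_K)%type.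
pose phi Th (c : C) := scaled_loss r g gamma dt Th (cell_rep x0 c) c.2.
pose bad (c : {ffun 'I_n -> C}) :=
  `[< exists Th, n%:R * eta < deviation (@cell_prob M) phi Th c >].
(* Supplies the default parameter that [deviation_tail] asks for. *)
pose Th0 : 'I_K -> resnet_param R d m D L := fun=> ResnetParam 0 0 (fun=> 0) (fun=> 0).
have tail : \sum_(c | bad c) prod_weight (@cell_prob M) c <= delta.
  apply: le_trans hdelta; rewrite expRD mulrA.
  have -> : expR (- (t * n%:R * eta)) = expR (- (t * (n%:R * eta))) by rewrite mulrA.
  apply: deviation_tail => //.
  - exact: cell_prob_ge0.
  - exact: cell_prob_sum1.
  (* The 8 is the Gaussian constant 2 at the parameter doubled by symmetrization. *)
  move=> c; rewrite (_ : 8 * t ^+ 2 = 2 * (2 * t) ^+ 2); last by ring.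
  have t20 : 0 <= 2 * t by rewrite mulr_ge0.
  apply: (@rad_bound_loss R alpha d m D L r g gamma dt gamma01 n
    (fun i => cell_rep x0 (c i)) (fun i => (c i).2) (2 * t) d0 t20) => i.
  by apply: admissible_S; exact: cell_rep_S.
exists (\bigcup_(c in [set c | ~~ bad c]) config_event c); split.
  apply: fin_bigcup_measurable; first exact: finite_finset.
  by move=> c _; exact: measurable_config_event.
split.
  rewrite measure_finite_disjoint_bigcup;
    [|exact: measurable_config_event|exact: config_event_uniq].
  under eq_bigr do rewrite config_event_prob.
  rewrite sumEFin lee_fin lerBlDr -(sum_prod_weight (n := n) (@cell_prob_sum1 M)).
  by rewrite (bigID bad) /= addrC lerD2l.
move=> w [c /= /asboolPn good cw]; split.
  by move=> i; have [h _] := cw i I; exact: state_cell_S h.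
move=> Th; apply: (le_trans (pop_loss_le M0 x0 Th)); rewrite lee_fin.
apply: (le_trans _ (lerD (emp_loss_ge M0 x0 Th cw) (lexx _))).
rewrite -mulrDr ler_pM2l ?exprn_gt0 ?bellman_scale_gt0//.
have hgood : deviation (@cell_prob M) phi Th c <= n%:R * eta.
  by rewrite leNgt; apply/negP => h; apply: good; exists Th.
have : pmean (@cell_prob M) phi Th - n%:R^-1 * \sum_i phi Th (c i) <= eta.
  move: hgood; rewrite -ler_pdivrMl// /deviation sumrB sumr_const card_ord mulrBr.
  by rewrite -[pmean _ _ _ *+ _]mulr_natl mulKf ?gt_eqF.
move: hM; rewrite /phi; lra.
Qed.

End UniformDeviation.

(** * Comparison with the explicit family *)

Lemma expR_half_le2 (R : realType) : expR (2^-1) <= 2 :> R.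
Proof.
have h : 2^-1 < 1 :> R by lra.
by rewrite (le_trans (expR_le_invB1 h))// (_ : 1 - 2^-1 = 2^-1) ?invrK//; lra.
Qed.

Lemma ln2_ge_half (R : realType) : 2^-1 <= ln 2 :> R.
Proof. by rewrite -[2^-1](expRK (R := R)) ler_ln ?posrE ?expR_gt0// expR_half_le2. Qed.

Lemma ln_ge1 (R : realType) (x : R) : 4 <= x -> 1 <= ln x.
Proof.
move=> x4; rewrite -[1](expRK (R := R)) ler_ln ?posrE ?expR_gt0//; last by lra.
rewrite (le_trans _ x4)// (_ : 1 = 2^-1 + 2^-1); last by lra.
rewrite expRD; have := expR_half_le2 R; have := expR_ge0 (2^-1 : R); nra.
Qed.

Lemma max_act_addr (R : realType) alpha (F : 'I_(2 ^ alpha) -> R) k :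
  max_act (fun a => F a + k) = max_act F + k.
Proof.
apply/le_anti; apply/andP; split.
  by apply: max_act_le => a; rewrite lerD2r; exact: max_act_ge.
rewrite -lerBrDr; apply: max_act_le => a; rewrite lerBrDr.
exact: (max_act_ge (fun a => F a + k)).
Qed.

Lemma ler_abs_linf (R : realType) d (x : 'rV[R]_d) j : `|x 0 j| <= linf x.
Proof. by rewrite /linf (bigD1 j)//= le_max lexx. Qed.

(** For [t = tau / Num.sqrt n%:R] the exponent is [8 * tau ^+ 2 - tau * (lam - 1)], linear in [lam].
    Using [lam - 1] in place of [lam] keeps a margin for the discretization. *)
Lemma deviation_budget (R : realType) (d alpha n : nat) (lam delta : R) :
  (0 < d)%N -> (0 < n)%N -> 0 < delta < 1 ->
  72 * (2 ^ alpha)%:R ^+ 3 * Num.sqrt (2 * ln (2 * d%:R))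
    + 9 * ln ((2 ^ alpha)%:R / delta) + 18 < lam ->
  exists t, 0 <= t /\
  3 ^+ (alpha.+1 + 2 * 2 ^ alpha) * (8 * d%:R) *
    expR (8 * t ^+ 2 * n%:R - t * n%:R * ((lam - 1) / Num.sqrt n%:R)) <= delta.
Proof.
move=> d0 n0 /andP[delta0 delta1] hlam.
have n0' : 0 < n%:R :> R by rewrite ltr0n.
have sn0 : 0 < Num.sqrt n%:R :> R by rewrite sqrtr_gt0.
have d1 : 1 <= d%:R :> R by rewrite ler1n.
set tau := Num.sqrt _ in hlam; exists (tau / Num.sqrt n%:R).
split; first by rewrite divr_ge0 ?sqrtr_ge0.
have ln2d : 2^-1 <= ln (2 * d%:R) :> R.
  by rewrite (le_trans (ln2_ge_half R))// ler_ln ?posrE//; lra.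
have tau2 : tau ^+ 2 = 2 * ln (2 * d%:R) by rewrite sqr_sqrtr//; lra.
have tau0 : 0 <= tau by rewrite sqrtr_ge0.
have tau1 : 1 <= tau by move: tau2 tau0; nra.
set K : R := (2 ^ alpha)%:R in hlam.
have K1 : 1 <= K by rewrite ler1n expn_gt0.
have lnKd : - ln delta <= ln (K / delta).
  by rewrite -lnV ?posrE// ler_ln ?posrE ?invr_gt0 ?divr_gt0//;
     [rewrite ler_peMl// invr_ge0 ltW|lra].
have lnd : ln delta <= 0 by rewrite ln_le0// ltW.
have sq : Num.sqrt n%:R ^+ 2 = n%:R :> R by rewrite sqr_sqrtr// ltW.
have -> : 8 * (tau / Num.sqrt n%:R) ^+ 2 * n%:R -
    tau / Num.sqrt n%:R * n%:R * ((lam - 1) / Num.sqrt n%:R) = 8 * tau ^+ 2 - tau * (lam - 1).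
  set sn := Num.sqrt n%:R in sq sn0 *.
  by rewrite -sq; field; rewrite gt_eqF.
(* Uses [3 <= expR 2] and [alpha + 1 <= 2 ^ alpha]. *)
have h3 : 3 ^+ (alpha.+1 + 2 * 2 ^ alpha) <= expR (6 * K).
  apply: (@le_trans _ _ (expR 2 ^+ (alpha.+1 + 2 * 2 ^ alpha))).
    by rewrite lerXn2r ?nnegrE ?expR_ge0//; have := expR_ge1Dx (2 : R); lra.
  rewrite -expRM_natr ler_expR (_ : 6 * K = 2 * (3 * 2 ^ alpha)%:R); last by rewrite natrM; ring.
  by rewrite ler_pM2l// ler_nat (mulSn 2) leq_add2r ltn_expl.
(* By the choice of [tau], [expR (tau ^+ 2 / 2)] equals [2 * d%:R]; the remaining 4 is below
   [expR 3]. *)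
have h8 : 8 * d%:R <= expR (3 + tau ^+ 2 / 2).
  rewrite expRD tau2 (_ : 2 * ln (2 * d%:R) / 2 = ln (2 * d%:R)); last by field.
  rewrite lnK; last by rewrite posrE; lra.
  rewrite (_ : 8 * d%:R = 4 * (2 * d%:R)); last by ring.
  by rewrite ler_wpM2r//; have := expR_ge1Dx (3 : R); lra.
rewrite -[leRHS]lnK ?posrE//.
apply: (@le_trans _ _ (expR (6 * K) * expR (3 + tau ^+ 2 / 2) *
    expR (8 * tau ^+ 2 - tau * (lam - 1)))).
  by rewrite ler_wpM2r ?expR_ge0// ler_pM// ?exprn_ge0 ?mulr_ge0.
rewrite -!expRD ler_expR.
have K3 : K <= K ^+ 3 by rewrite -[leLHS]mulr1 exprS ler_wpM2l ?expr_ge1//; lra.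
have tl : 72 * K ^+ 3 * tau ^+ 2 - 9 * ln delta + 17 <= tau * (lam - 1).
  have : 72 * K ^+ 3 * tau + 9 * - ln delta + 17 <= lam - 1 by lra.
  move=> h; have := ler_wpM2l tau0 h; nra.
have : 72 * K <= 72 * K ^+ 3 * tau ^+ 2 by nra.
have : 72 * tau ^+ 2 <= 72 * K ^+ 3 * tau ^+ 2 by nra.
lra.
Qed.

Section Comparator.
Context {R : realType} {alpha d n : nat} (m : nat).
Variables (S : set 'rV[R]_d) (gamma dt CT rB : R) (r : 'rV[R]_d -> 'I_(2 ^ alpha) -> R).
Variable g : 'rV[R]_d -> 'I_(2 ^ alpha) -> R -> 'rV[R]_d.
Variables (s : 'I_n -> 'rV[R]_d) (a : 'I_n -> 'I_(2 ^ alpha)) (B : 'I_(2 ^ alpha) -> R).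
Hypotheses (m0 : (0 < m)%N) (n0 : (0 < n)%N) (gamma0 : 0 < gamma) (gamma1 : gamma < 1).
Hypothesis S01 : forall x, S x -> forall i, 0 <= x ord0 i <= 1.
Hypothesis sS : forall i, S (s i).
Hypothesis BE : forall b, barron_sq S (r^~ b) = (B b)%:E.
Hypotheses (rB0 : 0 <= rB) (rBE : rB ^+ 2 = \sum_b B b).
Hypothesis CTdt0 : 0 <= CT * dt.
Hypothesis gCT : forall i b, linf (s i - g (s i) b dt) <= CT * dt.
Local Notation K := (2 ^ alpha)%N.
Local Notation c := (gamma / (1 - gamma)).

Lemma bellman_comparator :
  exists Th : 'I_K -> resnet_param R d ((6 ^ alpha + 1) * m) (d + K).+1 alpha.+1,
    emp_loss r g gamma dt s a Th <=
      4 * rB ^+ 2 / m%:R + 4 * c ^+ 2 * (CT * dt) ^+ 2 * rB ^+ 2 /\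
    family_path_norm Th <= 6 * K%:R ^+ 3 * Num.sqrt K%:R * rB / (1 - gamma).
Proof.
have m0' : 0 < m%:R :> R by rewrite ltr0n.
have n0' : 0 < n%:R :> R by rewrite ltr0n.
have g1' : 0 < 1 - gamma by rewrite subr_gt0.
have c0 : 0 <= c by rewrite divr_ge0 ?ltW.
have s1 i j : `|s i 0 j| <= 1.
  by have /andP[x0 x1] := S01 (sS i) j; rewrite ger0_norm.
(* The weights are the indicators of [a i == b]: the reward of [b] is approximated only where [b] is
   played, so the errors of all actions add up without a factor [K]. *)
have om01 b i : 0 <= ((a i == b)%:R : R) <= 1 by case: (a i == b); rewrite /= ?ler01 ?lexx.
have /choice[zs hzs] b := barron_approx n0 m0 (BE b) sS s1 (om01 b).
have e4 : 2 ^+ 2 = 4 :> R by ring.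
have L0 := mc_weight_ge0 zs.
have B0 b : 0 <= B b.
  by have := (hzs b).2; have := sqr_ge0 (mc_weight zs b); rewrite /mc_weight; lra.
have LB b : mc_weight zs b ^+ 2 <= 4 * B b := (hzs b).2.
have L2 b : mc_weight zs b <= 2 * rB.
  rewrite -(@ler_pXn2r _ 2) ?nnegrE ?L0 ?mulr_ge0// (le_trans (LB b))//.
  by rewrite exprMn e4 rBE (bigD1 b)//= mulrDr lerDl mulr_ge0// sumr_ge0// => b' _.
pose M x := max_act ((mc_approx zs)^~ x).
exists (fun b => bellman_net zs b c); split; last first.
  pose LL := \sum_b mc_weight zs b.
  have LL0 : 0 <= LL by exact: sumr_ge0.
  have hLL : LL <= 2 * (Num.sqrt K%:R * rB).
    rewrite -(@ler_pXn2r _ 2) ?nnegrE ?mulr_ge0 ?sqrtr_ge0//.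
    rewrite (le_trans (sqr_sum_le _))// card_ord !exprMn e4 sqr_sqrtr// rBE mulrCA ler_wpM2l//.
    by rewrite mulr_sumr; apply: ler_sum => b _.
  have K1 : 1 <= K%:R :> R by rewrite ler1n expn_gt0.
  apply: (@le_trans _ _ (\sum_(b < K) (3 * mc_weight zs b + c * (4 ^+ alpha * (3 * LL))))).
    by apply: ler_sum => b _; have [_] := bellman_net_correct zs b (s (Ordinal n0)) m0 c0.
  rewrite big_split /= -mulr_sumr sumr_const card_ord -/LL -[X in _ + X]mulr_natl.
  have -> : 4 ^+ alpha = K%:R ^+ 2 :> R.
    by rewrite natrX exprAC e4.
  (* The [K ^+ 3] combines [4 ^+ alpha = K ^+ 2] from the tournament rounds with the sum over the
     [K] networks; the further factor [Num.sqrt K] is the Cauchy-Schwarz bound [hLL]. *)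
  have -> : 3 * LL + K%:R * (c * (K%:R ^+ 2 * (3 * LL))) = 3 * LL * (1 + K%:R ^+ 3 * c) by ring.
  apply: (@le_trans _ _ (3 * (2 * (Num.sqrt K%:R * rB)) * (K%:R ^+ 3 / (1 - gamma)))); last first.
    by rewrite le_eqVlt; apply/orP; left; apply/eqP; ring.
  have K3 : 1 <= K%:R ^+ 3 :> R by rewrite expr_ge1//; lra.
  apply: ler_pM; rewrite ?mulr_ge0//.
  - by rewrite addr_ge0// mulr_ge0// exprn_ge0//; lra.
  - by rewrite ler_pM2l.
  - rewrite -(ler_pM2r g1') divfK ?gt_eqF// mulrDl mul1r -mulrA divfK ?gt_eqF//.
    have := mulr_ge0 (ltW g1') (_ : 0 <= K%:R ^+ 3 - 1); rewrite subr_ge0 => /(_ K3); nra.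
have netE b x : resnet (bellman_net zs b c) x = mc_approx zs b x + c * M x.
  by have [] := bellman_net_correct zs b x m0 c0.
pose e i := mc_approx zs (a i) (s i) - r (s i) (a i).
have resE i : bellman_res r g gamma dt (fun b => bellman_net zs b c) (s i) (a i) =
    e i + c * (M (s i) - M (g (s i) (a i) dt)).
  rewrite /bellman_res netE /e.
  rewrite (_ : (fun a' => _) = fun a' => mc_approx zs a' (g (s i) (a i) dt) +
    c * M (g (s i) (a i) dt)); last by apply/funext => b; rewrite netE.
  rewrite max_act_addr -/(M _); field; lra.
have hM i : `|M (s i) - M (g (s i) (a i) dt)| <= 2 * rB * (CT * dt).
  apply: max_act_dist => b; rewrite -mulrBr normrM -sumrB.
  rewrite (le_trans _ (ler_wpM2r CTdt0 (L2 b)))// ger0_norm ?invr_ge0//.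
  rewrite /mc_weight -mulrA ler_wpM2l ?invr_ge0// mulr_suml.
  rewrite (le_trans (ler_norm_sum _ _ _))//; apply: ler_sum => j _.
  apply: neuron_lip => q; rewrite (le_trans _ (gCT i (a i)))//.
  by have := ler_abs_linf (s i - g (s i) (a i) dt) q; rewrite !mxE.
have he : \sum_i e i ^+ 2 <= 4 * n%:R * rB ^+ 2 / m%:R.
  have -> : \sum_i e i ^+ 2 = \sum_b \sum_i (a i == b)%:R *
      (mc_approx zs b (s i) - r (s i) b) ^+ 2.
    rewrite exchange_big; apply: eq_bigr => i _ /=.
    rewrite (bigD1 (a i))//= eqxx mul1r big1 ?addr0// => b.
    by rewrite eq_sym => /negPf ->; rewrite mul0r.
  rewrite rBE mulr_sumr mulr_suml; apply: ler_sum => b _; exact: (hzs b).1.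
have hr i : bellman_res r g gamma dt (fun b => bellman_net zs b c) (s i) (a i) ^+ 2 <=
    2 * e i ^+ 2 + 8 * (c ^+ 2 * (CT * dt) ^+ 2 * rB ^+ 2).
  rewrite resE; set D := M _ - M _ in resE *.
  have hD : D ^+ 2 <= (2 * rB * (CT * dt)) ^+ 2.
    have := hM i; rewrite -/D => hDi.
    by rewrite -real_normK ?num_real// ler_pXn2r ?nnegrE ?(mulr_ge0 _ CTdt0) ?mulr_ge0.
  have hcD : c ^+ 2 * D ^+ 2 <= c ^+ 2 * (2 * rB * (CT * dt)) ^+ 2.
    by rewrite ler_wpM2l ?sqr_ge0.
  rewrite (_ : 8 * _ = 2 * (c ^+ 2 * (2 * rB * (CT * dt)) ^+ 2)); last by ring.
  rewrite (_ : (e i + c * D) ^+ 2 = 2 * e i ^+ 2 + 2 * (c ^+ 2 * D ^+ 2) -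
    (e i - c * D) ^+ 2); last by ring.
  by have := sqr_ge0 (e i - c * D); lra.
rewrite /emp_loss.
apply: (@le_trans _ _ ((2 * n%:R)^-1 * (2 * (4 * n%:R * rB ^+ 2 / m%:R) +
    n%:R * (8 * (c ^+ 2 * (CT * dt) ^+ 2 * rB ^+ 2))))); last first.
  rewrite le_eqVlt; apply/orP; left; apply/eqP; field.
  by apply/and3P; split; lra.
rewrite ler_pM2l ?invr_gt0 ?mulr_gt0//.
apply: (le_trans (ler_sum _ (fun i _ => hr i))).
rewrite big_split /= -mulr_sumr sumr_const card_ord -[_ *+ n]mulr_natl lerD2r.
by rewrite ler_pM2l.
Qed.

End Comparator.

(** * Arithmetic of the final bound *)

Lemma ln4S_le (R : realType) (x y : R) : 0 <= x -> x <= y ->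
  1 <= ln (4 * (x + 1)) /\ ln (4 * (x + 1)) <= ln (4 * (y + 1)).
Proof.
move=> x0 xy; split; first by apply: ln_ge1; lra.
by rewrite ler_ln ?posrE; lra.
Qed.

(** The factor 18 is granted to the nonnegative empirical loss as well, so that the whole objective
    of the minimizer appears and can be exchanged for the competitor's. *)
Lemma penalized_comparison (R : realFieldType) (RD eS eT mu Lam LamT l lT : R) :
  0 <= mu -> 0 <= eS -> 0 <= Lam -> 1 <= l ->
  RD <= eS + (3 * Lam + 1) ^+ 2 * mu ->
  eS + mu * Lam ^+ 2 * l <= eT + mu * LamT ^+ 2 * lT ->
  RD <= 18 * (eT + mu * LamT ^+ 2 * lT) + 2 * mu.
Proof.
move=> mu0 eS0 Lam0 l1 hRD hmin; rewrite (le_trans hRD)//.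
have h1 : (3 * Lam + 1) ^+ 2 * mu <= (18 * Lam ^+ 2 + 2) * mu.
  rewrite ler_wpM2r// (_ : _ ^+ 2 = 18 * Lam ^+ 2 + 2 - (3 * Lam - 1) ^+ 2); last by ring.
    by rewrite gerBl sqr_ge0.
have h2 : mu * Lam ^+ 2 <= mu * Lam ^+ 2 * l by rewrite ler_peMr// mulr_ge0 ?sqr_ge0.
lra.
Qed.

Lemma budget_split (R : realFieldType) (u G A l1 l2 : R) :
  0 <= u -> 0 <= G -> 1 <= A -> 0 <= l1 -> 0 <= l2 ->
  576 * u * G * (9 * l1) + 2 * G * 1 <= (576 * u + 2) * G * (A + 9 * l1 + 9 * l2).
Proof.
move=> u0 G0 A1 l10 l20; rewrite -subr_ge0.
rewrite (_ : _ - _ = 576 * (u * G * (A + 9 * l2)) + 2 * (G * (A - 1)) + 18 * (G * l1) +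
  18 * (G * l2)); last by ring.
have h1 : 0 <= u * G * (A + 9 * l2) by apply: mulr_ge0; [exact: mulr_ge0|lra].
have h2 : 0 <= G * (A - 1) by apply: mulr_ge0 => //; lra.
have h3 := mulr_ge0 G0 l10; have h4 := mulr_ge0 G0 l20; lra.
Qed.

(** Term by term: 72 against 256, 72 against 576, 648 against 576 times 9, and the leftover
    [2 * (lam / sn)] is covered by the [+ 2] of the last factor because [1 <= A]. *)
Lemma final_budget (R : realType) (K x gamma CT dt lam sn M A l1 l2 : R) :
  1 <= K -> 0 <= x -> 0 < gamma < 1 -> 0 < M -> 0 <= lam -> 0 < sn ->
  1 <= A -> 0 <= l1 -> 0 <= l2 ->
  18 * (4 * x ^+ 2 / M + 4 * (gamma / (1 - gamma)) ^+ 2 * (CT * dt) ^+ 2 * x ^+ 2 +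
    lam / sn * (36 * K ^+ 7 * x ^+ 2 / (1 - gamma) ^+ 2) * l1) + 2 * (lam / sn) <=
  ((1 - gamma) ^+ 2)^-1 * (256 * K ^+ 5 * x ^+ 2 / M
     + 576 * gamma ^+ 2 * CT ^+ 2 * dt ^+ 2 * K ^+ 7 * x ^+ 2)
   + (576 * x ^+ 2 + 2) * K ^+ 7 * (lam + 1) / ((1 - gamma) ^+ 2 * sn) * (A + 9 * l1 + 9 * l2).
Proof.
move=> K1 x0 /andP[g0 g1] M0 lam0 sn0 A1 l10 l20.
have g1' : 0 < 1 - gamma by rewrite subr_gt0.
set w := ((1 - gamma) ^+ 2)^-1.
have w0 : 0 < w by rewrite invr_gt0 exprn_gt0.
have w1 : 1 <= w by rewrite invf_ge1 ?exprn_gt0// expr_le1 ?(ltW g1')//; lra.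
have K5 : 1 <= K ^+ 5 by rewrite expr_ge1//; lra.
have K7 : 1 <= K ^+ 7 by rewrite expr_ge1//; lra.
set q := x ^+ 2 / M; set v := gamma ^+ 2 * CT ^+ 2 * dt ^+ 2 * x ^+ 2.
have q0 : 0 <= q by rewrite divr_ge0 ?sqr_ge0// ltW.
have v0 : 0 <= v by rewrite /v -!exprMn sqr_ge0.
set G := K ^+ 7 * w * ((lam + 1) / sn).
have G0 : 0 <= G.
  by apply: mulr_ge0; [apply: mulr_ge0; lra|apply: divr_ge0; lra].
have lG : lam / sn <= G.
  apply: (@le_trans _ _ ((lam + 1) / sn)); first by rewrite ler_wpM2r ?invr_ge0 ?(ltW sn0)//; lra.
  have h : 1 <= K ^+ 7 * w by rewrite mulr_ege1.
  by rewrite ler_peMl// divr_ge0 ?(ltW sn0)//; lra.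
have lG' : K ^+ 7 * w * (lam / sn) <= G.
  apply: ler_wpM2l; first by apply: mulr_ge0; lra.
  by rewrite ler_wpM2r ?invr_ge0 ?(ltW sn0)//; lra.
have -> : 18 * (4 * x ^+ 2 / M + 4 * (gamma / (1 - gamma)) ^+ 2 * (CT * dt) ^+ 2 * x ^+ 2 +
    lam / sn * (36 * K ^+ 7 * x ^+ 2 / (1 - gamma) ^+ 2) * l1) + 2 * (lam / sn) =
  72 * q + 72 * (w * v) + 648 * x ^+ 2 * (K ^+ 7 * w * (lam / sn)) * l1 + 2 * (lam / sn).
  by rewrite /q /w /v; field; apply/and3P; split; lra.
have -> : w * (256 * K ^+ 5 * x ^+ 2 / M
     + 576 * gamma ^+ 2 * CT ^+ 2 * dt ^+ 2 * K ^+ 7 * x ^+ 2)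
   + (576 * x ^+ 2 + 2) * K ^+ 7 * (lam + 1) / ((1 - gamma) ^+ 2 * sn) * (A + 9 * l1 + 9 * l2) =
   256 * (w * K ^+ 5) * q + 576 * K ^+ 7 * (w * v) +
   (576 * x ^+ 2 + 2) * G * (A + 9 * l1 + 9 * l2).
  by rewrite /q /w /v /G /w; field; apply/and3P; split; lra.
clearbody q v G w.
have lamsn0 : 0 <= lam / sn by apply: divr_ge0; lra.
have h1 : 72 * q <= 256 * (w * K ^+ 5) * q.
  by rewrite ler_wpM2r//; have := mulr_ege1 w1 K5; lra.
have h2 : 72 * (w * v) <= 576 * K ^+ 7 * (w * v).
  by apply: ler_wpM2r; [apply: mulr_ge0; lra|lra].
have x2 : 0 <= x ^+ 2 by rewrite sqr_ge0.
have h3 : 648 * x ^+ 2 * (K ^+ 7 * w * (lam / sn)) * l1 <= 5184 * x ^+ 2 * G * l1.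
  apply: ler_wpM2r; first exact: l10.
  apply: ler_pM; [lra| |lra|exact: lG'].
  by apply: mulr_ge0 => //; apply: mulr_ge0; lra.
have h4 : (576 * x ^+ 2) * G * (9 * l1) + 2 * G * 1 <=
    (576 * x ^+ 2 + 2) * G * (A + 9 * l1 + 9 * l2).
  exact: budget_split.
lra.
Qed.

Theorem theorem3p1 (d alpha : nat) : (0 < d)%N ->
  exists D0 : nat, (0 < D0)%N /\
  forall (R : realType) (m : nat), (0 < m)%N ->
  forall (S : set 'rV[R]_d) (gamma dt CT : R)
         (r : 'rV[R]_d -> 'I_(2 ^ alpha) -> R)
         (g : 'rV[R]_d -> 'I_(2 ^ alpha) -> R -> 'rV[R]_d)
         (rB : R) (delta lam : R) (n : nat),
  (* state space *)
  compact S ->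
  (forall s, S s -> forall i, 0 <= s ord0 i <= 1) ->
  (0 < leb_vol S)%E ->
  0 < gamma < 1 ->
  (* reward *)
  (forall a, {within S, continuous (r^~ a)}) ->
  (forall a, barron_space S (r^~ a)) ->
  (forall s a, S s -> `|r s a| <= 1) ->
  (* rB = ||r||_B *)
  0 <= rB -> (rB ^+ 2)%:E = (\sum_(a < 2 ^ alpha) barron_sq S (r^~ a))%E ->
  (* transition *)
  (forall s a t, S s -> 0 <= t -> S (g s a t)) ->
  (forall s a, S s -> g s a 0 = s) ->
  (forall s a t t', S s -> 0 <= t -> 0 <= t' -> g (g s a t) a t' = g s a (t + t')) ->
  0 < CT ->
  (forall s a t Dl, S s -> 0 <= t -> 0 < Dl < 1 ->
     linf (g s a t - g s a (t + Dl)) <= CT * Dl) ->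
  0 < dt < 1 ->
  (forall a B, rV_measurable B -> rV_measurable (S `&` (fun s => g s a dt) @^-1` B)) ->
  (* confidence, sample size, regularization *)
  0 < delta < 1 -> (0 < n)%N ->
  72 * (2 ^ alpha)%:R ^+ 3 * Num.sqrt (2 * ln (2 * d%:R))
    + 9 * ln ((2 ^ alpha)%:R / delta) + 18 < lam ->
  forall (dO : measure_display) (O : measurableType dO) (P : probability O R)
         (s : 'I_n -> O -> 'rV[R]_d) (a : 'I_n -> O -> 'I_(2 ^ alpha)),
  iid_sample S P s a ->
  exists E : set O, measurable E /\ ((1 - delta)%:E <= P E)%E /\
  forall w, E w ->
  forall Th : 'I_(2 ^ alpha) -> resnet_param R d ((6 ^ alpha + 1) * m) D0 alpha.+1,
  (forall Th' : 'I_(2 ^ alpha) -> resnet_param R d ((6 ^ alpha + 1) * m) D0 alpha.+1,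
      reg_obj r g gamma dt lam (fun i => s i w) (fun i => a i w) Th
      <= reg_obj r g gamma dt lam (fun i => s i w) (fun i => a i w) Th') ->
  (pop_loss S r g gamma dt Th <=
   (((1 - gamma) ^+ 2)^-1 *
     (256 * (2 ^ alpha)%:R ^+ 5 * rB ^+ 2 / m%:R
      + 576 * gamma ^+ 2 * CT ^+ 2 * dt ^+ 2 * (2 ^ alpha)%:R ^+ 7 * rB ^+ 2)
   + (576 * rB ^+ 2 + 2) * (2 ^ alpha)%:R ^+ 7 * (lam + 1)
       / ((1 - gamma) ^+ 2 * Num.sqrt n%:R)
     * (72 * (2 ^ alpha)%:R ^+ 3 * Num.sqrt (2 * ln (2 * d%:R))
        + 9 * ln (4 * (24 / (1 - gamma) * ((2 ^ alpha)%:R ^+ 3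
                        * Num.sqrt (2 ^ alpha)%:R) * rB + 1))
        + 9 * ln ((2 ^ alpha)%:R / delta)))%:E)%E.
Proof.
(* The width holds the input, one tournament slot per action and one copy. *)
move=> d0; exists (d + 2 ^ alpha).+1; split=> // R m m0 S gamma dt CT r g rB delta lam n.
move=> _ S01 _ /andP[gamma0 gamma1] _ _ r1 rB0 rBE gS g0 _ CT0 glip /andP[dt0 dt1] mg.
move=> delta01 n0 hlam dO O P s a iid.
have n0' : 0 < n%:R :> R by rewrite ltr0n.
have sn0 : 0 < Num.sqrt n%:R :> R by rewrite sqrtr_gt0.
pose B b := fine (barron_sq S (r^~ b)).
have bge0 b : (0 <= barron_sq S (r^~ b))%E.
  apply: le_ereal_inf_tmp => _ [rho _ <-].
  by apply: integral_ge0 => z _; rewrite lee_fin mulr_ge0 ?sqr_ge0.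
have BE b : barron_sq S (r^~ b) = (B b)%:E.
  rewrite fineK// ge0_fin_numE// (le_lt_trans _ (ltry (rB ^+ 2)))// rBE (bigD1 b)//=.
  by rewrite leeDl// sume_ge0.
have rBE' : rB ^+ 2 = \sum_b B b.
  by apply: EFin_inj; rewrite rBE -sumEFin; apply: eq_bigr.
have /choice[Lr hLr] b : exists Lr, 0 <= Lr /\ forall x y delta, S x -> S y -> 0 <= delta ->
    (forall j, `|x 0 j - y 0 j| <= delta) -> `|r x b - r y b| <= Lr * delta.
  by have [Lr Lr0 h] := barron_lip (BE b); exists Lr.
have Lr0 : 0 <= \sum_b Lr b by apply: sumr_ge0 => b _; exact: (hLr b).1.
have rlip b x y (dl : R) : S x -> S y -> 0 <= dl -> (forall j, `|x 0 j - y 0 j| <= dl) ->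
    `|r x b - r y b| <= (\sum_b Lr b) * dl.
  move=> Sx Sy dl0 xy; rewrite (le_trans ((hLr b).2 _ _ _ Sx Sy dl0 xy))// ler_wpM2r//.
  by rewrite (bigD1 b)//= lerDl sumr_ge0// => b' _; exact: (hLr b').1.
have gamma01 : 0 <= gamma <= 1 by rewrite !ltW.
have gSdt x b : S x -> S (g x b dt) by move=> Sx; apply: gS => //; exact: ltW.
have [t [t0 ht]] := deviation_budget d0 n0 delta01 hlam.
(* The tail is computed at the lower level and used at the upper one, which matches the
   regularization weight. *)
have lt_eta : (lam - 1) / Num.sqrt n%:R < lam / Num.sqrt n%:R.
  by rewrite ltr_pM2r ?invr_gt0//; lra.
have [E [mE [PE hE]]] := @uniform_deviation R alpha d ((6 ^ alpha + 1) * m) (d + 2 ^ alpha).+1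
  alpha.+1 n S gamma dt r g dO O P s a _ d0 n0 gamma01 Lr0 S01 r1 rlip gSdt mg
  iid t _ _ delta t0 lt_eta ht.
exists E; split=> //; split=> // w Ew Th hTh.
have [sS hpop] := hE w Ew; apply: (le_trans (hpop Th)); rewrite lee_fin.
have gCT i b : linf (s i w - g (s i w) b dt) <= CT * dt.
  by have := glip (s i w) b 0 dt (sS i) (lexx _); rewrite g0// add0r dt0 dt1; apply.
have CTdt0 : 0 <= CT * dt by rewrite mulr_ge0 ?ltW.
(* The competitor is built for the sample at [w], after [E] has been fixed. *)
have [ThT [empT normT]] := @bellman_comparator R alpha d n m S gamma dt CT rB r g
  (fun i => s i w) (fun i => a i w) B m0 n0 gamma0 gamma1 S01 sS BE rB0 rBE' CTdt0 gCT.
set K : R := (2 ^ alpha)%:R.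
have K1 : 1 <= K by rewrite ler1n expn_gt0.
have d1 : 1 <= d%:R :> R by rewrite ler1n.
have tau1 : 1 <= Num.sqrt (2 * ln (2 * d%:R)) :> R.
  have ln2d : 2^-1 <= ln (2 * d%:R) :> R.
    by rewrite (le_trans (ln2_ge_half R))// ler_ln ?posrE//; lra.
  by rewrite -[leLHS]sqrtr1 ler_wsqrtr//; lra.
have K3 : 1 <= K ^+ 3 by rewrite expr_ge1//; lra.
have A1 : 1 <= 72 * K ^+ 3 * Num.sqrt (2 * ln (2 * d%:R)).
  by rewrite !mulr_ege1//; lra.
have /andP[delta0 delta1] := delta01.
have l20 : 0 <= ln (K / delta).
  by apply: ln_ge0; rewrite ler_pdivlMr// mul1r; lra.
have lam0 : 0 <= lam by move: hlam; rewrite -/K; lra.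
have g1' : 0 < 1 - gamma by rewrite subr_gt0.
set Y := 6 * K ^+ 3 * Num.sqrt K * rB / (1 - gamma) in normT.
set Y' := 24 / (1 - gamma) * (K ^+ 3 * Num.sqrt K) * rB.
have Y0 : 0 <= Y by rewrite !mulr_ge0 ?invr_ge0 ?sqrtr_ge0 ?(ltW g1')//; lra.
have YY' : Y <= Y' by rewrite (_ : Y' = 4 * Y); [lra|rewrite /Y /Y'; ring].
have NT0 := family_path_norm_ge0 ThT; have N0 := family_path_norm_ge0 Th.
have [lTh _] := ln4S_le N0 (lexx _).
have [lT1 lTY] := ln4S_le NT0 (le_trans normT YY').
have mu0 : 0 <= lam / Num.sqrt n%:R by rewrite divr_ge0// ltW.
have emp0 : 0 <= emp_loss r g gamma dt (fun i => s i w) (fun i => a i w) Th.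
  rewrite /emp_loss mulr_ge0 ?invr_ge0 ?mulr_ge0// ?(ltW n0')//.
  by apply: sumr_ge0 => i _; exact: sqr_ge0.
apply: (le_trans (penalized_comparison mu0 emp0 N0 lTh (lexx _) (hTh ThT))).
apply: le_trans (final_budget CT dt K1 rB0 (_ : 0 < gamma < 1) (_ : 0 < m%:R) lam0 sn0 A1
  (le_trans (le_trans ler01 lT1) lTY) l20); [|by rewrite gamma0|by rewrite ltr0n].
rewrite lerD2r ler_pM2l// lerD//.
have YE : Y ^+ 2 = 36 * K ^+ 7 * rB ^+ 2 / (1 - gamma) ^+ 2.
  have KK : Num.sqrt K ^+ 2 = K by rewrite sqr_sqrtr//; lra.
  rewrite (_ : K ^+ 7 = K ^+ 6 * Num.sqrt K ^+ 2); last by rewrite KK; ring.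
  by rewrite /Y; field; lra.
rewrite -YE; apply: ler_pM => //; first by rewrite mulr_ge0 ?sqr_ge0.
  exact: (le_trans ler01 lT1).
by rewrite ler_wpM2l// ler_pXn2r ?nnegrE.
Qed.
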